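(* Let $f(x)=\frac{1}{x+1}$, let $\mathcal{D}=\{(x,y)\in\mathbb{R}^2:x\ge0,\ 0\le y\le f(x)\}$, and let $T_5:M_5\to M_5$ be the billiard map of $\mathcal{D}$, preserving the infinite measure $\mu$ (as defined in the context). Then $T_5$ is polynomially F-mixing: there exist $\alpha>0$, a measurable set $A\subset M_5$ with piecewise differentiable boundary and $0<\mu(A)<\infty$, and a constant $C>0$ (depending on $A$) such that $$\mu(T_5^{-n}A\cap A)\ \ge\ C\,\frac{1}{n^{\alpha}}$$ for all sufficiently large $n$.
   Context: Billiard. A point particle moves freely (straight lines, unit speed) in $\mathcal{D}$ with elastic collisions at the boundary (angle of incidence equals angle of reflection). Let $\mathcal{U}=\{(x,f(x)):x\ge0\}$ be the dispersing part of the boundary, $\mathcal{L}=\{(0,y):0\le y\le f(0)\}$ the vertical wall and $V=(0,f(0))$. Collisions are recorded by $(r,\varphi)$, where $r$ is an arc length parameter on $\mathcal{U}\cup\mathcal{L}$ with $r=0$ at $V$, $r<0$ on $\mathcal{U}$ and $r>0$ on $\mathcal{L}$, and $\varphi\in(-\pi/2,\pi/2)$ is the angle between the outgoing velocity and the inward normal at the collision point. Let $M=(-\infty,0)\times(-\pi/2,\pi/2)$ (collisions on $\mathcal{U}$), $M_4$ the set of $(r,\varphi)$ based on $\mathcal{L}$, and $M_5=M\cup M_4$. The billiard map $T_5:M_5\to M_5$ sends a collision with $\mathcal{U}\cup\mathcal{L}$ to the next collision with $\mathcal{U}\cup\mathcal{L}$ (reflections at the horizontal side are not recorded); it is defined outside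 a $\mu$-null set of singular points (trajectories hitting $\mathcal{U}$ tangentially or ending in a vertex), and preserves the infinite $\sigma$-finite measure $d\mu=\cos\varphi\,dr\,d\varphi$. *)

(* Defs.v *)
From HB Require Import structures.
From mathcomp Require Import all_boot all_order all_algebra.
From mathcomp Require Import all_classical all_reals all_analysis.

Set Implicit Arguments.
Unset Strict Implicit.
Unset Printing Implicit Defensive.

Import Order.TTheory GRing.Theory Num.Theory.
Import numFieldNormedType.Exports.

Local Open Scope classical_set_scope.
Local Open Scope ring_scope.

Definition table (R : realType) (f : R -> R) : set (R * R) :=
  [set q | 0 <= q.1 /\ 0 <= q.2 <= f q.1].

(* Length of the graph of [f] between the vertex [(0, f 0)] and [(x, f x)]. *)
Definition arclength (R : realType) (f : R -> R) (x : R) : R :=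
  \int[lebesgue_measure]_(t in `[0, x]) Num.sqrt (1 + (derive1 f t) ^+ 2).

(* For [r < 0], the abscissa of the point of the graph whose arc length
   parameter is [r]; the default value [0] is never used when the graph has
   infinite length. *)
Definition abscissa (R : realType) (f : R -> R) (r : R) : R :=
  xget 0 [set x | 0 <= x /\ arclength f x = - r].

Definition foot (R : realType) (f : R -> R) (r : R) : R * R :=
  if r < 0 then (abscissa f r, f (abscissa f r)) else (0, f 0 - r).

(* Unit normal pointing into the table. *)
Definition normal (R : realType) (f : R -> R) (r : R) : R * R :=
  if r < 0 then
    let m := derive1 f (abscissa f r) in (Num.sqrt (1 + m ^+ 2))^-1 *: (m, -1)
  else (1, 0).

(* Unit tangent in the direction of increasing [r]: [normal] is obtained from
   it by a counterclockwise quarter turn. *)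
Definition tangent (R : realType) (f : R -> R) (r : R) : R * R :=
  ((normal f r).2, - (normal f r).1).

(* [phi] is the signed angle from the inward normal to the outgoing velocity,
   positive towards increasing [r]. *)
Definition velocity (R : realType) (f : R -> R) (p : R * R) : R * R :=
  cos p.2 *: normal f p.1 + sin p.2 *: tangent f p.1.

(* The arc length parameters of the points of the dispersing side and of the
   vertical wall, the vertices [(0, f 0)] and [(0, 0)] being left out. *)
Definition sides (R : realType) (f : R -> R) : set R :=
  [set r | r < 0 \/ 0 < r < f 0].

Definition M5 (R : realType) (f : R -> R) : set (R * R) :=
  [set p | sides f p.1 /\ - (pi / 2) < p.2 < pi / 2].

(* [v] after an elastic collision with a side of unit normal [n]. *)
Definition reflect_velocity (R : realType) (n v : R * R) : R * R :=
  v - (2 * (v.1 * n.1 + v.2 * n.2)) *: n.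

(* The particle leaving [q] with velocity [v] first reaches the boundary of
   the table at [q']. *)
Definition free_flight (R : realType) (f : R -> R) (q v q' : R * R) : Prop :=
  exists tau : R, [/\ 0 < tau, q' = q + tau *: v,
    (forall s, 0 < s < tau -> (table f)° (q + s *: v)) &
    (table f `\` (table f)°) q'].

(* [next_hit f q v r v']: starting at [q] with velocity [v], and possibly after
   reflections at the horizontal side, the particle next collides with the
   dispersing side or the vertical wall at [foot f r], and leaves with
   velocity [v']. *)
Inductive next_hit (R : realType) (f : R -> R) :
    R * R -> R * R -> R -> R * R -> Prop :=
| hit_side q v r : sides f r -> free_flight f q v (foot f r) ->
    next_hit f q v r (reflect_velocity (normal f r) v)
| hit_floor q v x r v' : 0 < x -> free_flight f q v (x, 0) ->
    next_hit f (x, 0) (reflect_velocity (0, 1) v) r v' ->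
    next_hit f q v r v'.

(* Trajectories ending in a vertex or hitting a side tangentially have no
   successor, the latter because [M5] excludes the angles [pi / 2] and
   [- (pi / 2)]. *)
Definition next_collision (R : realType) (f : R -> R) (p p' : R * R) : Prop :=
  [/\ M5 f p, M5 f p' &
      next_hit f (foot f p.1) (velocity f p) p'.1 (velocity f p')].

(* The billiard map, a partial map: [None] at singular points. *)
Definition T5 (R : realType) (f : R -> R) (p : R * R) : option (R * R) :=
  xget None (Some @` next_collision f p).

Definition T5_iter (R : realType) (f : R -> R) (n : nat) (p : R * R) :
    option (R * R) :=
  iter n (obind (T5 f)) (Some p).

Definition T5_preimage (R : realType) (f : R -> R) (n : nat)
    (A : set (R * R)) : set (R * R) :=
  [set p | M5 f p /\ exists2 p', T5_iter f n p = Some p' & A p'].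

Definition mu (R : realType) (f : R -> R) (A : set (R * R)) : \bar R :=
  (\int[lebesgue_measure \x lebesgue_measure]_(p in A `&` M5 f)
     (cos p.2)%:E)%E.

(* The boundary is a finite union of regular differentiable arcs; without
   regularity a single parametrization could hide infinitely many corners. *)
Definition piecewise_differentiable_boundary (R : realType)
    (A : set (R * R)) : Prop :=
  exists (k : nat) (c : 'I_k -> R -> R * R),
    (forall i t, t \in `[0, 1] -> derivable (c i) t 1 /\ derive1 (c i) t != 0) /\
    closure A `\` A° = \bigcup_i (c i @` `[0, 1]).

(* Main.v *)
Require Import Defs.
From mathcomp Require Import all_boot all_order all_algebra.
From mathcomp Require Import all_classical all_reals all_analysis.
From mathcomp Require Import ring lra zify.

(** The set [A] is the rectangle of all collisions with the vertical wall, and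
the returns that are exhibited consist of a single excursion: the particle
leaves the wall, hits the curve [n - 1] times and comes back to the wall.

In the abscissa [X = x + 1] the curve is [X * Y = 1].  After a collision at [X]
let the velocity point at the angle [Theta] below the positive horizontal.  The
floor is reached at [X + cot Theta / X], the next collision takes place at the
[X'] with [X + cot Theta / X = X' - cot Theta / X'], and there [Theta] increases
by [2 * arctan (X' ^- 2)].  With the half-angle tangent [a = tan (Theta / 2)]
the reflection reads [a' * (1 - a / X' ^+ 2) = a + X' ^- 2] and
[cot Theta = (1 / a - a) / 2], so an excursion is an orbit of an explicit
algebraic map, defined as long as [0 < Theta < pi].

Existence of excursions of each length.  A particle that enters the cusp
horizontally at height [1 / b] starts with [X = b] and [a = b ^- 2].  If it ever
moves perpendicularly to the floor, or hits the curve perpendicularly, it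
retraces its path by time reversal and leaves horizontally.  For [b] close to
[1] it turns back at once, for [b] large it takes many collisions to turn by a
right angle, and the intermediate value theorem in [b] gives a perpendicular
floor crossing or collision at any prescribed index: [traversal_exists].

Stability of these excursions.  Tangents are superadditive and [X] increases on
the way in, hence [a >= k / X ^+ 2] after the [k]-th collision
([half_orbit_ge]).  This is the estimate that matters: it implies that a flight
and a reflection at [j] collisions from the nearer end multiply the relative
errors of [X] and [a] by at most [1 + 10 / j] each ([flight_stable],
[turn_stable]).  The product of these factors grows like a power of [n] only,
so all particles that start within a fixed multiple of [n ^- 42] of the
symmetric orbit accompany it for the whole excursion ([shadow], [shadow_exit],
[return_box]).  They form a square of measure at least a multiple of [n ^- 84].
*)

Import Order.TTheory GRing.Theory Num.Theory.
Import numFieldNormedType.Exports.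
Local Open Scope classical_set_scope.
Local Open Scope ring_scope.

Set Implicit Arguments.
Unset Strict Implicit.
Unset Printing Implicit Defensive.

Local Notation hyperbola := (fun x => (x + 1)^-1).

(** * Sensitivity of one flight and of one reflection *)

Lemma expNr2_itv (R : realFieldType) (y : R) : 1 < y -> 0 < y ^- 2 < 1.
Proof.
move=> y1; have y0 : 0 < y by lra.
by rewrite invr_gt0 exprn_gt0 //= invf_lt1 ?exprn_gt0 // exprn_egt1.
Qed.

Lemma expNr2_le (R : realFieldType) (x y : R) : 0 < x -> x <= y -> y ^- 2 <= x ^- 2.
Proof.
move=> x0 xy; have y0 : 0 < y by lra.
by rewrite lef_pV2 ?posrE ?exprn_gt0 // ler_sqr ?nnegrE; lra.
Qed.

Lemma expNr2_near (R : realFieldType) (X x e : R) : 0 < X -> 0 <= e <= 100^-1 ->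
  `|x - X| <= e * X -> `|x ^- 2 - X ^- 2| <= 21/10 * e * X ^- 2.
Proof.
move=> X0 /andP[e0 e1] hx.
have eX : e * X <= 100^-1 * X by apply: ler_wpM2r => //; exact: ltW.
have [x1 x2] : X * (1 - e) <= x /\ x <= X * (1 + e).
  by move: hx; rewrite ler_norml => /andP[? ?]; split; lra.
have x0 : 0 < x by lra.
have y0 : 0 <= X * (1 - e) by lra.
have X2 : 0 < X ^+ 2 by rewrite exprn_gt0.
have up : x ^+ 2 <= X ^+ 2 * (1 + e) ^+ 2 by rewrite -exprMn; apply: lerXn2r; rewrite ?nnegrE; lra.
have lo : X ^+ 2 * (1 - e) ^+ 2 <= x ^+ 2 by rewrite -exprMn; apply: lerXn2r; rewrite ?nnegrE; lra.
have xx : 0 < x ^+ 2 by rewrite exprn_gt0.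
have b0 : 0 < X ^- 2 by rewrite invr_gt0.
have bX : X ^- 2 * X ^+ 2 = 1 by rewrite mulVf // gt_eqF.
clear eX x1 x2 y0 x0 hx X0.
have ee : 0 <= e * e by rewrite mulr_ge0.
have ee1 : e * e <= 100^-1 * e by apply: ler_wpM2r.
have eee : 0 <= e * e * e by rewrite !mulr_ge0.
have eee1 : e * e * e <= 100^-1 * (100^-1 * e).
  by have := ler_wpM2r e0 ee1; lra.
have f : (1 - 21/10 * e) * (1 + e) ^+ 2 <= 1 by rewrite expr2; lra.
have g : 1 <= (1 + 21/10 * e) * (1 - e) ^+ 2 by rewrite expr2; lra.
have h1 : X ^- 2 * (1 - 21/10 * e) <= x ^- 2.
  rewrite -(ler_pM2r xx) mulVf ?gt_eqF //.
  have h : X ^- 2 * (1 - 21/10 * e) * x ^+ 2 <= X ^- 2 * (1 - 21/10 * e) * (X ^+ 2 * (1 + e) ^+ 2).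
    by apply: ler_wpM2l => //; apply: mulr_ge0; [exact: ltW | lra].
  apply: le_trans h _.
  have -> : X ^- 2 * (1 - 21/10 * e) * (X ^+ 2 * (1 + e) ^+ 2) = X ^- 2 * X ^+ 2 * ((1 - 21/10 * e) * (1 + e) ^+ 2).
    by ring.
  by rewrite bX mul1r.
have h2 : x ^- 2 <= X ^- 2 * (1 + 21/10 * e).
  rewrite -(ler_pM2r xx) mulVf ?gt_eqF //.
  have h : X ^- 2 * (1 + 21/10 * e) * (X ^+ 2 * (1 - e) ^+ 2) <= X ^- 2 * (1 + 21/10 * e) * x ^+ 2.
    by apply: ler_wpM2l => //; apply: mulr_ge0; [exact: ltW | lra].
  apply: le_trans h.
  have -> : X ^- 2 * (1 + 21/10 * e) * (X ^+ 2 * (1 - e) ^+ 2) = X ^- 2 * X ^+ 2 * ((1 + 21/10 * e) * (1 - e) ^+ 2).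
    by ring.
  by rewrite bX mul1r.
by rewrite ler_norml; apply/andP; split; lra.
Qed.

(** The cotangent of an angle as a function of the tangent of its half. *)
Definition cotan (R : realFieldType) (a : R) : R := (a^-1 - a) / 2.

Lemma cotan_ge0 (R : realFieldType) (a : R) : 0 < a <= 1 -> 0 <= cotan a.
Proof.
move=> /andP[a0 a1]; have i1 : 1 <= a^-1 by rewrite invf_ge1.
by rewrite /cotan; lra.
Qed.

Lemma cotanV (R : realFieldType) (a : R) : cotan a^-1 = - cotan a.
Proof. by rewrite /cotan invrK; ring. Qed.

Lemma cotan_le (R : realFieldType) (a l : R) :
  0 < a -> a <= l -> a^-1 <= l -> `|cotan a| <= l / 2.
Proof.
move=> a0 h1 h2; have i0 : 0 < a^-1 by rewrite invr_gt0.
by rewrite /cotan ler_norml; apply/andP; split; lra.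
Qed.

Lemma cotan_perturb (R : realFieldType) (a t l E : R) :
  0 < a -> a <= l -> a^-1 <= l -> 0 <= E <= 100^-1 -> `|t - a| <= E * a ->
  [/\ 0 < t, `|cotan t| <= 51/100 * l & `|cotan t - cotan a| <= 101/100 * E * l].
Proof.
move=> a0 al ial /andP[E0 E1] ht.
have Ea : E * a <= 100^-1 * a by apply: ler_wpM2r => //; exact: ltW.
have [t1 t2] : 99/100 * a <= t /\ t <= 101/100 * a.
  by move: ht; rewrite ler_norml => /andP[? ?]; split; lra.
have t0 : 0 < t by lra.
have it : t^-1 <= 102/100 * a^-1.
  have ia0 : 0 < a^-1 by rewrite invr_gt0.
  have h : a^-1 * (99/100 * a) <= a^-1 * t by apply: ler_wpM2l => //; exact: ltW.
  have aa : a^-1 * a = 1 by rewrite mulVf // gt_eqF.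
  by rewrite -[leLHS]mul1r ler_pdivrMr //; lra.
have i0 : 0 < t^-1 by rewrite invr_gt0.
split=> //.
  have h1 : t <= 102/100 * l by lra.
  have h2 : t^-1 <= 102/100 * l by lra.
  by apply: le_trans (cotan_le t0 h1 h2) _; lra.
have -> : cotan t - cotan a = - (t - a) * ((t * a)^-1 + 1) / 2.
  by rewrite /cotan; field; rewrite !gt_eqF.
have ta0 : 0 < (t * a)^-1 by rewrite invr_gt0 mulr_gt0.
rewrite normrM normrM normrN [`|2^-1|]gtr0_norm ?invr_gt0 //.
rewrite [`|_^-1 + 1|]gtr0_norm; last by lra.
have h1 : `|t - a| * ((t * a)^-1 + 1) <= E * a * ((t * a)^-1 + 1).
  by apply: ler_wpM2r => //; lra.
have h2 : E * a * ((t * a)^-1 + 1) = E * (t^-1 + a) by field; rewrite !gt_eqF.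
have h3 : E * (t^-1 + a) <= E * (202/100 * l) by apply: ler_wpM2l => //; lra.
by lra.
Qed.

(** The derivative of [X + c / X] differs from [1] by [c / X ^+ 2]; the mixed
product [X * y] appears because finite differences are used instead of
derivatives. *)
Lemma shear_le (R : realFieldType) (X y c k Q : R) :
  0 < X -> Q <= X ^+ 2 -> 0 <= k -> 99/100 * X <= y -> `|c| <= 51/100 * (k * Q) ->
  `|c / (X * y)| <= 52/100 * k.
Proof.
move=> X0 QX k0 yl cl; have y0 : 0 < y by lra.
have Xy : 0 < X * y by rewrite mulr_gt0.
rewrite normrM normfV (gtr0_norm Xy) ler_pdivrMr //; apply: le_trans cl _.
have h1 : X * (99/100 * X) <= X * y by apply: ler_wpM2l => //; exact: ltW.
have h2 : k * (99/100 * Q) <= k * (X * y).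
  by apply: ler_wpM2l => //; rewrite expr2 in QX; lra.
have h3 : 0 <= k * (X * y) by rewrite mulr_ge0 // ltW.
by lra.
Qed.

Lemma sum_inv_le (R : realFieldType) (X X' Q c m : R) :
  0 < X -> 0 < X' -> 0 < Q -> Q <= X ^+ 2 -> Q <= X' ^+ 2 -> `|c| <= m * Q ->
  0 <= m -> `|c * (X^-1 + X'^-1)| <= 2 * m * X'.
Proof.
move=> X0 X'0 Q0 QX QX' cm m0.
have iX : 0 < X^-1 + X'^-1 by rewrite addr_gt0 ?invr_gt0.
have QXX : Q <= X * X'.
  have XX0 : 0 <= X * X' by rewrite mulr_ge0 // ltW.
  rewrite -(ler_sqr (ltW Q0 : Q \is Num.nneg) (XX0 : _ \is Num.nneg)) exprMn.
  by rewrite [leLHS]expr2; apply: ler_pM => //; exact: ltW.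
have QiX : Q / X <= X' by rewrite ler_pdivrMr // mulrC.
have QiX' : Q / X' <= X' by rewrite ler_pdivrMr // -expr2.
rewrite normrM (gtr0_norm iX).
have h1 : `|c| * (X^-1 + X'^-1) <= m * Q * (X^-1 + X'^-1).
  by apply: ler_wpM2r => //; exact: ltW.
have h2 : m * Q * (X^-1 + X'^-1) = m * (Q / X + Q / X') by ring.
have h3 : m * (Q / X + Q / X') <= m * (X' + X') by apply: ler_wpM2l => //; lra.
by lra.
Qed.

(** The equation of a flight, [y - c / y = x + c / x] with [c = cotan t], is
perturbed by this amount when [(X, a)] is replaced by [(x, t)] while the end
point [X'] is kept.  The first term is at most [E * X' * (1 + O(k))] because
[c / X ^+ 2] is [O(k)] and [X <= X' * (1 + k)], the second is [E * X' * O(k)]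
because [a] times the derivative of [cotan] at [a] is at most [k * Q]. *)
Lemma flight_drift (R : realFieldType) (X X' x a t Q k E : R) :
  0 < X -> 0 < X' -> 0 < a -> 0 < Q -> Q <= X ^+ 2 -> Q <= X' ^+ 2 ->
  0 <= k <= 1 -> a <= k * Q -> a^-1 <= k * Q ->
  X + cotan a / X = X' - cotan a / X' ->
  0 <= E <= 100^-1 -> `|x - X| <= E * X -> `|t - a| <= E * a ->
  `|(x - X) * (1 - cotan t / (X * x)) + (cotan t - cotan a) * (X^-1 + X'^-1)| <=
    E * X' * (1 + 42/10 * k).
Proof.
move=> X0 X'0 a0 Q0 QX QX' /andP[k0 k1] ak iak hX E01 hx ht.
have [t0 ct dc] := cotan_perturb a0 ak iak E01 ht.
have ca : `|cotan a| <= k / 2 * Q by apply: le_trans (cotan_le a0 ak iak) _; lra.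
case/andP: (E01) => E0 E1.
have XX : X <= X' * (1 + k).
  have h := sum_inv_le X0 X'0 Q0 QX QX' ca (divr_ge0 k0 (ler0n _ 2)).
  have -> : X = X' - cotan a * (X^-1 + X'^-1) by rewrite mulrDr; lra.
  by move: h; rewrite ler_norml => /andP[? ?]; lra.
have b2 : `|(cotan t - cotan a) * (X^-1 + X'^-1)| <= 202/100 * (E * k * X').
  have Ek : 0 <= 101/100 * (E * k) by rewrite mulr_ge0 // mulr_ge0.
  have dc' : `|cotan t - cotan a| <= 101/100 * (E * k) * Q by apply: le_trans dc _; lra.
  by apply: le_trans (sum_inv_le X0 X'0 Q0 QX QX' dc' Ek) _; lra.
have xl : 99/100 * X <= x.
  have : E * X <= 100^-1 * X by apply: ler_wpM2r => //; exact: ltW.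
  by move: hx; rewrite ler_norml => /andP[? ?] ?; lra.
have c1 := shear_le X0 QX k0 xl ct.
have b1 : `|(x - X) * (1 - cotan t / (X * x))| <= E * X * (1 + 52/100 * k).
  rewrite normrM; apply: ler_pM => //.
  move: (_ / _) c1 => c; clear => c1.
  by move: c1; rewrite !ler_norml => /andP[? ?]; apply/andP; split; lra.
apply: le_trans (ler_normD _ _) _.
clear -b1 b2 XX E0 k0 k1 X'0.
have b3 : X * (1 + 52/100 * k) <= X' * (1 + 204/100 * k).
  have h1 : X * (1 + 52/100 * k) <= X' * (1 + k) * (1 + 52/100 * k).
    by apply: ler_wpM2r => //; lra.
  have h2 : X' * ((1 + k) * (1 + 52/100 * k)) <= X' * (1 + 204/100 * k).
    apply: ler_wpM2l; first exact: ltW.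
    have : 0 <= k * (1 - k) by rewrite mulr_ge0 // subr_ge0.
    by lra.
  by lra.
have b4 : E * (X * (1 + 52/100 * k)) <= E * (X' * (1 + 204/100 * k)) by apply: ler_wpM2l.
have b5 : 0 <= E * k * X' by rewrite mulr_ge0 ?mulr_ge0 // ltW.
by lra.
Qed.

(** At relative distance [E'] from [X'] the function [y - c / y], whose slope is
at least [1 - O(k)], has moved by more than the drift [E * X' * (1 + O(k))]:
this is what the factor [1 + 10 * k] between [E] and [E'] pays for. *)
Lemma flight_bracket (R : realFieldType) (X X' x a t Q k E E' : R) :
  0 < X -> 0 < X' -> 0 < a -> 0 < Q -> Q <= X ^+ 2 -> Q <= X' ^+ 2 ->
  0 <= k <= 1 -> a <= k * Q -> a^-1 <= k * Q ->
  X + cotan a / X = X' - cotan a / X' ->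
  0 <= E -> E' = E * (1 + 10 * k) -> E' <= 100^-1 ->
  `|x - X| <= E * X -> `|t - a| <= E * a ->
  X' * (1 - E') - cotan t / (X' * (1 - E')) <= x + cotan t / x
    <= X' * (1 + E') - cotan t / (X' * (1 + E')).
Proof.
move=> X0 X'0 a0 Q0 QX QX' k01 ak iak hX E0 eE' E'1 hx ht.
case/andP: (k01) => k0 k1.
have Ek : 0 <= E * k by rewrite mulr_ge0.
have EE' : E <= E' by rewrite eE'; lra.
have E01 : 0 <= E <= 100^-1 by rewrite E0 /=; exact: le_trans E'1.
have [t0 ct _] := cotan_perturb a0 ak iak E01 ht.
have := flight_drift X0 X'0 a0 Q0 QX QX' k01 ak iak hX E01 hx ht.
set B := (X in `|X|) => hB.
have x0 : 0 < x.
  have : E * X <= 100^-1 * X by apply: ler_wpM2r; [exact: ltW | case/andP: E01].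
  by move: hx; rewrite ler_norml => /andP[? ?] ?; lra.
have diff y : 0 < y -> y - cotan t / y - (x + cotan t / x) =
    (y - X') * (1 + cotan t / (X' * y)) - B.
  move=> y0.
  have -> : y - cotan t / y - (x + cotan t / x) =
    (y - X') * (1 + cotan t / (X' * y)) - B +
    (X' - cotan a / X' - (X + cotan a / X)).
    by rewrite /B; field; rewrite !gt_eqF.
  by rewrite hX subrr addr0.
have shear y (yl : 99/100 * X' <= y) := shear_le X'0 QX' k0 yl ct.
have E'X : E * X' * (1 + 42/10 * k) <= E' * X' * (1 - 52/100 * k).
  have -> : E' * X' * (1 - 52/100 * k) = E * X' * ((1 + 10 * k) * (1 - 52/100 * k)).
    by rewrite eE'; ring.
  apply: ler_wpM2l; first by rewrite mulr_ge0 // ltW.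
  have : 0 <= k * (1 - k) by rewrite mulr_ge0 // subr_ge0.
  by lra.
have E'0 : 0 <= E' by exact: le_trans EE'.
have EX0 : 0 <= E' * X' by rewrite mulr_ge0 // ltW.
have EX1 : E' * X' <= 100^-1 * X' by apply: ler_wpM2r => //; exact: ltW.
move: diff shear hB => diff shear; rewrite ler_norml => /andP[B1 B2].
clearbody B; clear ct ht hx E01 hX iak ak QX QX' Q0 a0 X0 t0 x0.
have main s : 1 - 52/100 * k <= 1 + s -> E' * X' * (1 - 52/100 * k) <= E' * X' * (1 + s).
  by move=> h; apply: ler_wpM2l.
apply/andP; split.
  have yl : 99/100 * X' <= X' * (1 - E') by lra.
  have y0 : 0 < X' * (1 - E') by lra.
  rewrite -subr_le0 diff //; have := shear _ yl.
  have -> : X' * (1 - E') - X' = - (E' * X') by ring.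
  move: (cotan t / _) => s; rewrite ler_norml => /andP[s1 _].
  have /main : 1 - 52/100 * k <= 1 + s by lra.
  by lra.
have yl : 99/100 * X' <= X' * (1 + E') by lra.
have y0 : 0 < X' * (1 + E') by lra.
rewrite -subr_ge0 diff //; have := shear _ yl.
have -> : X' * (1 + E') - X' = E' * X' by ring.
move: (cotan t / _) => s; rewrite ler_norml => /andP[s1 _].
have /main : 1 - 52/100 * k <= 1 + s by lra.
by lra.
Qed.

(** The relative error of [a'] is that of [a] plus [O(k)] times that of [b].
Indeed [b] is at most a fraction [2 * k] of [a + b], and the relative error of
the denominator [1 - a * b] carries the factor [a * b], which is at most [k]. *)
Lemma turn_perturb (R : realFieldType) (a b a' t c k E E' : R) :
  0 < a -> 0 < b -> 0 < a' -> 0 <= k <= 1 -> 0 <= E <= E' -> E' <= 100^-1 ->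
  a' * b <= k -> b <= k * a' -> a' * (1 - a * b) = a + b ->
  `|c - b| <= 21/10 * E' * b -> `|t - a| <= E * a ->
  exists2 t', `|t' - a'| <= E' * (1 + 10 * k) * a' & t' * (1 - t * c) = t + c.
Proof.
move=> a0 b0 a'0 /andP[k0 k1] /andP[E0 EE] E1 h1 h2 ha hc ht.
have E'0 : 0 <= E' by exact: le_trans EE.
have ht' : `|t - a| <= E' * a by apply: le_trans ht _; apply: ler_wpM2r => //; exact: ltW.
have ab : 0 < a * b by rewrite mulr_gt0.
have Eb : E' * b <= 100^-1 * b by apply: ler_wpM2r => //; exact: ltW.
have D2 : a * b <= 2^-1.
  have e : a * b * (1 + a' * b) = a' * b - b ^+ 2 by rewrite expr2; nra.
  have h : 0 < a' * b by rewrite mulr_gt0.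
  have h' : a * b * (1 + a' * b) <= a' * b by rewrite e gerBl sqr_ge0.
  have p : 0 < 1 + a' * b by lra.
  by rewrite -(ler_pM2r p); lra.
set D := 1 - a * b in ha *.
have D1 : 2^-1 <= D by rewrite /D; lra.
have b2k : b <= 2 * k * (a + b).
  have h : a' * 2^-1 <= a' * D by apply: ler_wpM2l => //; exact: ltW.
  have : k * a' <= k * (2 * (a + b)) by apply: ler_wpM2l => //; lra.
  by lra.
set w := t * c - a * b.
have hw : `|w| <= 32/10 * E' * (a * b).
  have -> : w = (t - a) * c + a * (c - b) by rewrite /w; ring.
  have i1 : `|(t - a) * c| <= E' * a * (11/10 * b).
    rewrite normrM; apply: ler_pM => //.
    by move: hc; rewrite !ler_norml => /andP[? ?]; apply/andP; split; lra.
  have i2 : `|a * (c - b)| <= a * (21/10 * E' * b).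
    by rewrite normrM (gtr0_norm a0); apply: ler_wpM2l => //; exact: ltW.
  by apply: le_trans (ler_normD _ _) _; lra.
set u := (t - a) + (c - b).
have hu : `|u| <= E' * (a + 21/10 * b) by apply: le_trans (ler_normD _ _) _; lra.
have eD : 1 - t * c = D - w by rewrite /D /w; ring.
have eu : t + c = a' * D + u by rewrite ha /u; ring.
clearbody u w; clear hc ht ht' EE E0 h2 Eb.
have E'ab : E' * (a * b) <= 100^-1 * (a * b) by apply: ler_wpM2r => //; exact: ltW.
have Dw : 0 < D - w by move: hw; rewrite ler_norml => /andP[? ?]; lra.
have ka : a * b * a' <= k * a.
  by rewrite -mulrA (mulrC k) (mulrC b); apply: ler_wpM2l => //; exact: ltW.
have W : `|w * a'| <= 32/10 * E' * (k * a).
  rewrite normrM (gtr0_norm a'0).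
  have i1 : `|w| * a' <= 32/10 * E' * (a * b) * a' by apply: ler_wpM2r => //; exact: ltW.
  have i2 : E' * (a * b * a') <= E' * (k * a) by apply: ler_wpM2l.
  by lra.
have ka0 : 0 <= k * a by rewrite mulr_ge0 // ltW.
have kb0 : 0 <= k * b by rewrite mulr_ge0 // ltW.
have kka : k * (k * a) <= k * a by rewrite ler_piMl.
exists ((t + c) / (D - w)); last by rewrite eD mulfVK // gt_eqF.
have -> : (t + c) / (D - w) - a' = (u + w * a') / (D - w).
  by rewrite eu; field; rewrite gt_eqF.
rewrite normrM normfV (gtr0_norm Dw) ler_pdivrMr //.
have N : `|u + w * a'| <= E' * (a + 21/10 * b) + 32/10 * E' * (k * a).
  by apply: le_trans (ler_normD _ _) _; lra.
apply: le_trans N _.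
have Ewa : E' * (k * a) <= 100^-1 * (k * a) by apply: ler_wpM2r.
have rhs : a + b - 32/1000 * (k * a) <= a' * (D - w).
  by move: W; rewrite mulrBr ha (mulrC w) ler_norml => /andP[? ?]; lra.
have -> : E' * (a + 21/10 * b) + 32/10 * E' * (k * a) =
   E' * (a + 21/10 * b + 32/10 * (k * a)) by ring.
rewrite -!(mulrA E'); apply: ler_wpM2l => //.
have k10 : (1 + 10 * k) * (a + b - 32/1000 * (k * a)) <= (1 + 10 * k) * (a' * (D - w)).
  by apply: ler_wpM2l => //; lra.
rewrite -(mulrA (1 + 10 * k)); apply: le_trans _ k10; clear -ka0 kb0 kka b2k.
by lra.
Qed.

Lemma turn_stable (R : realFieldType) (X' x' a a' t k E E' : R) :
  0 < X' -> 0 < a -> 0 < a' -> 0 <= k <= 1 -> 0 <= E <= E' -> E' <= 100^-1 ->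
  a' / X' ^+ 2 <= k -> (a' * X' ^+ 2)^-1 <= k ->
  a' * (1 - a / X' ^+ 2) = a + X' ^- 2 ->
  `|x' - X'| <= E' * X' -> `|t - a| <= E * a ->
  exists2 t', `|t' - a'| <= E' * (1 + 10 * k) * a' &
    t' * (1 - t / x' ^+ 2) = t + x' ^- 2.
Proof.
move=> X0 a0 a'0 k01 EE E1 h1 h2 ha hx ht.
have E'01 : 0 <= E' <= 100^-1 by rewrite E1 andbT; case/andP: EE => e0; exact: le_trans.
apply: (turn_perturb a0 _ a'0 k01 EE E1 h1 _ ha (expNr2_near X0 E'01 hx) ht).
  by rewrite invr_gt0 exprn_gt0.
by move: h2; rewrite invfM mulrC -ler_pdivlMr ?invr_gt0 // invrK.
Qed.

(** [k] measures how singular the flight is: [c / X ^+ 2] and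
[1 / (X ^+ 2 * sin Theta)] are bounded by it, both for the departure and for the
arrival.  The perturbed end point is found by the intermediate value theorem, so
that the closeness to [X'] and the existence come together. *)
Lemma flight_stable (R : realType) (X X' x a t Q k E E' : R) :
  0 < X -> 0 < X' -> 0 < a -> 0 < Q -> Q <= X ^+ 2 -> Q <= X' ^+ 2 ->
  0 <= k <= 1 -> a <= k * Q -> a^-1 <= k * Q ->
  X + cotan a / X = X' - cotan a / X' ->
  0 <= E -> E' = E * (1 + 10 * k) -> E' <= 100^-1 ->
  `|x - X| <= E * X -> `|t - a| <= E * a ->
  exists2 x', `|x' - X'| <= E' * X' &
    x + cotan t / x = x' - cotan t / x'.
Proof.
move=> X0 X'0 a0 Q0 QX QX' k01 ak iak hX E0 eE' E'1 hx ht.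
have /andP[lo hi] := flight_bracket X0 X'0 a0 Q0 QX QX' k01 ak iak hX E0 eE' E'1 hx ht.
have E'0 : 0 <= E' by rewrite eE'; case/andP: k01 => ? ?; nra.
pose g y := y - cotan t / y.
have le1 : X' * (1 - E') <= X' * (1 + E') by nra.
have lo0 : 0 < X' * (1 - E') by nra.
have cg : {within `[X' * (1 - E'), X' * (1 + E')], continuous g}.
  apply: continuous_in_subspaceT => y; rewrite inE /= in_itv /= => /andP[y1 y2].
  have y0 : y != 0 by rewrite gt_eqF //; lra.
  apply: cvgB; first exact: cvg_id.
  apply: cvgM; first exact: cvg_cst.
  by apply: cvgV => //; exact: cvg_id.
have [|c] := @IVT _ g _ _ (x + cotan t / x) le1 cg.
  by rewrite ge_min lo le_max hi orbT.
rewrite in_itv /= => /andP[c1 c2] gc; exists c => //.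
by rewrite ler_norml; apply/andP; split; lra.
Qed.

(** * Symmetric excursions into the cusp *)

(** The positive root [X'] of [X' - c / X' = X + c / X] for [c >= 0]. *)
Definition next_abscissa (R : realType) (X a : R) : R :=
  let S := X + cotan a / X in (S + Num.sqrt (S ^+ 2 + 4 * cotan a)) / 2.

Lemma next_abscissaP (R : realType) (X a : R) : 0 < X -> 0 < a <= 1 ->
  let X' := next_abscissa X a in
  X <= X' /\ X + cotan a / X = X' - cotan a / X'.
Proof.
move=> X0 /cotan_ge0; rewrite /next_abscissa; set c := cotan a => c0.
set S := X + c / X; have XS : X <= S by rewrite lerDl divr_ge0 // ltW.
have D0 : 0 <= S ^+ 2 + 4 * c by rewrite addr_ge0 ?sqr_ge0 // mulr_ge0.
have SD : S <= Num.sqrt (S ^+ 2 + 4 * c).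
  rewrite -{1}(ger0_norm (le_trans (ltW X0) XS)) -sqrtr_sqr ler_sqrt //.
  by rewrite lerDl mulr_ge0.
move: (sqr_sqrtr D0) SD; set s := Num.sqrt _ => sq SD.
have X'0 : 0 < (S + s) / 2 by lra.
split; first by lra.
rewrite -/S; apply: (mulfI (lt0r_neq0 X'0)).
rewrite mulrBr [_ * (c / _)]mulrCA divff ?gt_eqF // mulr1.
have -> : c = (s ^+ 2 - S ^+ 2) / 4 by rewrite sq; lra.
by field.
Qed.

(** The direction is capped at [1], that is at the vertical, beyond which the
particle moves back.  With the cap the orbit is defined at all times and is
a continuous function of its initial abscissa. *)
Definition half_step (R : realType) (p : R * R) : R * R :=
  let X' := next_abscissa p.1 p.2 in
  (X', Num.min 1 ((p.2 + X' ^- 2) / (1 - p.2 / X' ^+ 2))).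

(** A particle coming in horizontally at abscissa [b] has [a = b ^- 2] after its
first collision. *)
Definition half_orbit (R : realType) (b : R) (k : nat) : R * R :=
  iter k (@half_step R) (b, b ^- 2).

Lemma half_orbit_inv (R : realType) (b : R) k : 1 < b ->
  [/\ b <= (half_orbit b k).1, 0 < (half_orbit b k).2 <= 1 &
      (half_orbit b k).1 <= (half_orbit b k.+1).1].
Proof.
move=> b1; have b0 : 0 < b by lra.
elim: k => [|k [h1 h2 h3]].
  have /andP[u v] := expNr2_itv b1.
  have w : 0 < b ^- 2 <= 1 by rewrite u ltW.
  by split => //=; have [] := next_abscissaP b0 w.
set p := half_orbit b k in h1 h2 h3 *.
have X1 : 1 < (half_orbit b k.+1).1 by lra.
have a01 : 0 < (half_orbit b k.+1).2 <= 1.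
  rewrite /half_orbit iterS -/(half_orbit b k) /= -/p.
  set X' := next_abscissa _ _; have /expNr2_itv/andP[u v] : 1 < X' by exact: X1.
  case/andP: h2 => h20 h21; rewrite ge_min lexx /= lt_min ltr01 /= andbT.
  by rewrite divr_gt0 //; [lra|nra].
split=> //; first by lra.
by have [] := next_abscissaP (lt_trans ltr01 X1) a01.
Qed.

Lemma half_orbit_flight (R : realType) (b : R) k : 1 < b ->
  let p := half_orbit b k in let q := half_orbit b k.+1 in
  p.1 + cotan p.2 / p.1 = q.1 - cotan p.2 / q.1.
Proof.
move=> b1; have [h1 h2 h3] := half_orbit_inv k b1.
have p0 : 0 < (half_orbit b k).1 by lra.
by have [] := next_abscissaP p0 h2.
Qed.

Lemma half_orbit_continuous (R : realType) (b : R) k : 1 < b ->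
  {for b, continuous (fun b => (half_orbit b k).1)} /\
  {for b, continuous (fun b => (half_orbit b k).2)}.
Proof.
move=> b1; elim: k => [|k [c1 c2]].
  have b0 : b != 0 by rewrite gt_eqF //; lra.
  split; first exact: cvg_id.
  by apply: cvgV; [rewrite expf_neq0 | exact: exprn_continuous].
have [h1 /andP[h20 h21] h3] := half_orbit_inv k b1.
have cc : {for b, continuous (fun b => cotan (half_orbit b k).2)}.
  by apply: cvgM; [apply: cvgB => //; apply: cvgV => //; rewrite gt_eqF | exact: cvg_cst].
have cS : {for b, continuous (fun b => (half_orbit b k).1 + cotan (half_orbit b k).2 / (half_orbit b k).1)}.
  apply: cvgD => //; apply: cvgM => //; apply: cvgV => //.
  by rewrite gt_eqF //; lra.
have cX : {for b, continuous (fun b => (half_orbit b k.+1).1)}.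
  rewrite /half_orbit /= /next_abscissa.
  apply: cvgM; last exact: cvg_cst.
  apply: cvgD => //.
  apply: (@cvg_comp _ _ _ _ Num.sqrt); last exact: sqrt_continuous.
  apply: cvgD; first exact: (cvgM cS cS).
  by apply: cvgM => //; exact: cvg_cst.
split; first exact: cX.
have X0 : 1 < (half_orbit b k.+1).1 by lra.
have ciX : {for b, continuous (fun b => (half_orbit b k.+1).1 ^- 2)}.
  apply: cvgV; first by rewrite gt_eqF // exprn_gt0 //; lra.
  exact: (cvgM cX cX).
have -> : (fun b => (half_orbit b k.+1).2) =
  (cst 1) \min (fun b => ((half_orbit b k).2 + (half_orbit b k.+1).1 ^- 2) /
          (1 - (half_orbit b k).2 * (half_orbit b k.+1).1 ^- 2)) by [].
apply: continuous_min; first exact: cvg_cst.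
apply: cvgM; first exact: cvgD.
apply: cvgV; last by apply: cvgB; [exact: cvg_cst | exact: cvgM].
rewrite gt_eqF // subr_gt0.
have : (half_orbit b k.+1).1 ^- 2 < 1.
  by rewrite invf_lt1 ?exprn_egt1 ?exprn_gt0 //; lra.
have : 0 < (half_orbit b k.+1).1 ^- 2 by rewrite invr_gt0 exprn_gt0 //; lra.
by nra.
Qed.

Lemma half_orbit_turn (R : realType) (b : R) k : 1 < b ->
  let a := (half_orbit b k).2 in let q := half_orbit b k.+1 in
  q.2 = Num.min 1 ((a + q.1 ^- 2) / (1 - a / q.1 ^+ 2)).
Proof. by []. Qed.

Lemma half_orbit_capped (R : realType) (b : R) k j : 1 < b -> (k <= j)%N ->
  (half_orbit b k).2 = 1 -> (half_orbit b j).2 = 1.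
Proof.
move=> b1; elim: j => [|j IH]; first by rewrite leqn0 => /eqP ->.
rewrite leq_eqVlt => /predU1P[-> //|]; rewrite ltnS => /IH{}IH /IH e.
rewrite half_orbit_turn // e; apply/min_idPl.
have [h1 _ h3] := half_orbit_inv j.+1 b1.
have /andP[u v] : 0 < (half_orbit b j.+1).1 ^- 2 < 1 by apply: expNr2_itv; lra.
by rewrite ler_pdivlMr; lra.
Qed.

Lemma half_orbit_turn_lt1 (R : realType) (b : R) k : 1 < b ->
  (half_orbit b k.+1).2 < 1 ->
  let a := (half_orbit b k).2 in let q := half_orbit b k.+1 in
  q.2 * (1 - a / q.1 ^+ 2) = a + q.1 ^- 2.
Proof.
move=> b1 lt1; have [h1 /andP[a0 a1] h3] := half_orbit_inv k b1.
have [h1' _ _] := half_orbit_inv k.+1 b1.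
have /andP[u v] : 0 < (half_orbit b k.+1).1 ^- 2 < 1 by apply: expNr2_itv; lra.
have D : 0 < 1 - (half_orbit b k).2 * (half_orbit b k.+1).1 ^- 2 by nra.
move: lt1; rewrite half_orbit_turn // gt_min ltxx /= => lt1.
have /min_idPr -> := ltW lt1.
by rewrite divfK // gt_eqF.
Qed.

(** The addition formula of the tangent gives [a_(k+1) >= a_k + X_(k+1) ^- 2], and
[X] increases.  The first collision gives equality for [k = 0]. *)
Lemma half_orbit_ge (R : realType) (b : R) k : 1 < b ->
  (forall i, (i <= k)%N -> (half_orbit b i).2 < 1) ->
  k.+1%:R <= (half_orbit b k).2 * (half_orbit b k).1 ^+ 2.
Proof.
move=> b1; elim: k => [|k IH] lt1.
  by rewrite /= mulVf // expf_neq0 // gt_eqF //; lra.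
have {}IH := IH (fun i ik => lt1 i (leqW ik)).
have e := half_orbit_turn_lt1 b1 (lt1 _ (leqnn _)).
have [h1 /andP[a0 a1] h3] := half_orbit_inv k b1.
have [h1' /andP[a0' a1'] _] := half_orbit_inv k.+1 b1.
move: IH e; set X := (half_orbit b k).1 in h1 h3 *; set a := (half_orbit b k).2 in a0 a1 *.
set X' := (half_orbit b k.+1).1 in h3 h1' *; set a' := (half_orbit b k.+1).2 in a0' a1' *.
move=> IH e.
have X'0 : X' ^+ 2 != 0 by rewrite expf_neq0 // gt_eqF //; lra.
have -> : a' * X' ^+ 2 = a * X' ^+ 2 + 1 + a * a'.
  have := congr1 (fun z => z * X' ^+ 2) e.
  rewrite mulrDl mulVf // -mulrA mulrBl mul1r divfK //.
  by lra.
rewrite -[k.+2]addn1 natrD.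
have : a * X ^+ 2 <= a * X' ^+ 2.
  by rewrite ler_wpM2l ?(ltW a0) // ler_sqr ?nnegrE; lra.
have : 0 <= a * a' by rewrite mulr_ge0 // ltW.
by lra.
Qed.

(** Tangents of small angles are almost additive.  Hence, far away in the cusp,
[m + 1] collisions do not suffice to turn the velocity by a right angle. *)
Lemma half_orbit_le (R : realType) (b : R) m k : 2 * m.+2%:R <= b -> (k <= m)%N ->
  (half_orbit b k).2 <= 2 * k.+1%:R / b ^+ 2.
Proof.
move=> bm; have m2 : 2 <= m.+2%:R :> R by rewrite ler_nat.
have b1 : 1 < b by lra.
have B0 : b ^+ 2 != 0 by rewrite expf_neq0 // gt_eqF //; lra.
elim: k => [_|k IH km].
  by rewrite /= ler_pdivlMr ?mulVf ?exprn_gt0 //; lra.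
have {IH} := IH (ltnW km).
have [h1 /andP[a0 a1] h3] := half_orbit_inv k b1.
have [h1' _ _] := half_orbit_inv k.+1 b1.
rewrite half_orbit_turn //.
set a := (half_orbit b k).2 in a0 a1 *; set X := (half_orbit b k.+1).1 in h1' *.
have X0 : 0 < X by lra.
have b0 : 0 < b by lra.
have le1 : X ^- 2 <= b ^- 2 by rewrite lef_pV2 ?posrE ?exprn_gt0 // ler_sqr ?nnegrE; lra.
have lt1 : 0 < X ^- 2 by rewrite invr_gt0 exprn_gt0.
have /andP[w0 w1] := expNr2_itv b1.
have kk : k.+2%:R = 1 + k.+1%:R :> R by rewrite -[k.+2]add1n natrD.
have km' : k.+1%:R <= m%:R :> R by rewrite ler_nat.
have mm : m.+2%:R = m%:R + 2 :> R by rewrite -[m.+2]addn2 natrD.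
set c : R := k.+1%:R in kk km' *.
have c0 : 0 < c by rewrite ltr0n.
move=> ha.
rewrite ge_min; apply/orP; right.
move: le1 lt1 w0 w1 ha; rewrite -[2 * c / b ^+ 2]/(2 * c * b ^- 2).
rewrite -[a / X ^+ 2]/(a * X ^- 2) -[_ / b ^+ 2]/(_ * b ^- 2).
move: (X ^- 2) => v le1 lt1.
have : (2 * (c + 2)) ^+ 2 * b ^- 2 <= 1.
  by rewrite ler_pdivrMr ?exprn_gt0 // mul1r ler_sqr ?nnegrE; lra.
move: (b ^- 2) le1 => u le1 hu w0 w1 ha.
have D : 0 < 1 - a * v by nra.
rewrite ler_pdivrMr //.
rewrite kk.
have av : a * v <= 2 * c * u * u by nra.
have : 2 * (1 + c) * u * (2 * c * u * u) <= u by nra.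
have : 2 * (1 + c) * u * (a * v) <= 2 * (1 + c) * u * (2 * c * u * u).
  by apply: ler_wpM2l => //; nra.
lra.
Qed.

(** Close to the wall the curve is steep enough for two collisions to turn a
horizontal velocity to the vertical or past it. *)
Lemma half_orbit_start (R : realType) : (half_orbit (11/10 : R) 1).2 = 1.
Proof.
have b1 : 1 < 11/10 :> R by lra.
rewrite half_orbit_turn //; apply/min_idPl.
have [h1' _ _] := half_orbit_inv 1 b1.
have [h1 /= /andP[a0 a1] h3] := half_orbit_inv 0 b1.
have cl : cotan ((11/10 : R) ^- 2) <= 2 / 10.
  have -> : cotan ((11/10 : R) ^- 2) = ((11/10) ^+ 2 - 100 / 121) / 2.
    by rewrite /cotan; field.
  by rewrite expr2; lra.
have c0 : 0 <= cotan ((11/10 : R) ^- 2) by apply: cotan_ge0; rewrite a0 a1.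
have e : 11/10 + cotan ((11/10 : R) ^- 2) / (11/10) =
  (half_orbit (11/10 : R) 1).1 - cotan ((11/10 : R) ^- 2) / (half_orbit (11/10 : R) 1).1.
  exact: half_orbit_flight 0 b1.
rewrite /= -[(11/10) ^- 2 / _]/((11/10) ^- 2 * next_abscissa _ _ ^- 2).
move: h1' h3 e; rewrite /=; move: (next_abscissa _ _) => X h1' h3 e.
move: (cotan _) e cl c0 => c e cl c0.
have XX : X <= 147/100.
  have i1 : X^-1 <= (11/10)^-1 by rewrite lef_pV2 ?posrE; lra.
  have i0 : 0 < X^-1 by rewrite invr_gt0; lra.
  have : X = 11/10 + c * ((11/10)^-1 + X^-1) by rewrite mulrDr; lra.
  have : c * ((11/10)^-1 + X^-1) <= 2/10 * (2 * (11/10)^-1).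
    by apply: ler_pM; lra.
  lra.
have v1 : (46/100 : R) <= X ^- 2.
  have X2 : 0 < X ^+ 2 by rewrite exprn_gt0 //; lra.
  rewrite -(ler_pM2r X2) mulVf ?gt_eqF //; nra.
have /andP[w0 w1] : 0 < X ^- 2 < 1 by apply: expNr2_itv; lra.
have -> : (11/10 : R) ^- 2 = 100/121 by field.
by rewrite ler_pdivlMr; lra.
Qed.

(** [psi] is the equation which expresses that the orbit is perpendicular to the
curve at its collision of index [m + 1], or to the floor just after it.  It is
positive on capped orbits, so that a solution is an orbit which has not been capped. *)
Lemma half_orbit_tune (R : realType) (psi : R -> R -> R) (m : nat) :
  (0 < m)%N ->
  (forall (u v : R -> R) x, {for x, continuous u} -> {for x, continuous v} ->
     {for x, continuous (fun x => psi (u x) (v x))}) ->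
  (forall v : R, 0 < v -> 0 < psi 1 v) ->
  (forall u v : R, 0 < u <= 2^-1 -> 0 < v <= 4^-1 -> psi u v < 0) ->
  exists b : R, [/\ 11/10 <= b, b <= 2 * m.+2%:R,
    psi (half_orbit b m).2 ((half_orbit b m.+1).1 ^- 2) = 0 &
    forall k, (k <= m)%N -> (half_orbit b k).2 < 1].
Proof.
move=> m0 cpsi psi1 psi0.
pose g b := psi (half_orbit b m).2 ((half_orbit b m.+1).1 ^- 2).
have m2 : 3 <= m.+2%:R :> R by rewrite ler_nat.
set B : R := 2 * m.+2%:R.
have le1 : 11/10 <= B by rewrite /B; lra.
have cg : {within `[11/10, B], continuous g}.
  apply: continuous_in_subspaceT => b; rewrite inE /= in_itv /= => /andP[b1 _].
  have {}b1 : 1 < b by lra.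
  have [cX _] := half_orbit_continuous m.+1 b1.
  have [_ ca] := half_orbit_continuous m b1.
  have [h1 _ _] := half_orbit_inv m.+1 b1.
  apply: (cpsi (fun b => (half_orbit b m).2) (fun b => (half_orbit b m.+1).1 ^- 2)) => //.
  by apply: cvgV; [rewrite expf_neq0 // gt_eqF //; lra | exact: (cvgM cX cX)].
have i2 (b : R) : 1 < b -> 0 < (half_orbit b m.+1).1 ^- 2.
  move=> b1; have [h1 _ _] := half_orbit_inv m.+1 b1.
  by rewrite invr_gt0 exprn_gt0 //; lra.
have g1 : 0 < g (11/10).
  have b1 : 1 < 11/10 :> R by lra.
  rewrite /g (half_orbit_capped b1 m0 (half_orbit_start R)).
  by apply: psi1; exact: i2.
have quad (M : R) : 3 <= M -> 2 * (M - 1) <= 2^-1 * (2 * M) ^+ 2.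
  move=> M3; have : 0 <= (M - 1) * (M - 1) by rewrite -expr2 sqr_ge0.
  by rewrite expr2; lra.
have g2 : g B < 0.
  have b1 : 1 < B by lra.
  have [_ /andP[a0 _] _] := half_orbit_inv m b1.
  have [h1 _ _] := half_orbit_inv m.+1 b1.
  have B2 : 0 < B ^+ 2 by rewrite exprn_gt0 //; lra.
  apply: psi0.
    rewrite a0 /=; apply: le_trans (half_orbit_le (lexx _) (leqnn m)) _.
    rewrite ler_pdivrMr // -/B.
    have -> : m.+1%:R = m.+2%:R - 1 :> R by rewrite -(natrB _ (isT : 1 <= m.+2)%N) subn1.
    exact: quad.
  rewrite i2 //=; have -> : (4 : R)^-1 = 2 ^- 2 by field.
  by apply: expNr2_le => //; apply: le_trans h1; rewrite /B; lra.
have [|b] := @IVT _ g _ _ 0 le1 cg.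
  by rewrite ge_min le_max (ltW g1) (ltW g2) orbT.
rewrite in_itv /= => /andP[b1 b2] gb0; exists b; split=> // k km.
have {}b1 : 1 < b by lra.
have [_ /andP[_ a1] _] := half_orbit_inv k b1.
rewrite lt_neqAle a1 andbT; apply/eqP => e.
have := psi1 _ (i2 _ b1); rewrite -[X in psi X](half_orbit_capped b1 km e).
by rewrite -[psi _ _]/(g b) gb0 ltxx.
Qed.

(** A reference excursion with [N] collisions, at the abscissas
[X 0, ..., X (N - 1)], the directions [A k] belonging to the flight from [X k] to
[X k.+1].  It enters horizontally, [A 0 = X 0 ^- 2], and leaves horizontally:
the direction after the last collision would have an infinite half-angle
tangent, which is what [trav_last] says.  In [trav_rate], [j] is the number of
collisions that separate the flight from the nearer end of the excursion; this
is the origin of the rates [1 / j] at which errors grow. *)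
Record traversal (R : realType) (N : nat) (X A : nat -> R) : Prop := Traversal {
  trav_ge : forall k, 11/10 <= X k;
  trav_le : X 0 <= N.+1%:R;
  trav_first : A 0 = X 0 ^- 2;
  trav_last : A N.-2 = X N.-1 ^+ 2;
  trav_dir : forall k, 0 < A k;
  trav_flight : forall k, (k.+1 < N)%N ->
    X k + cotan (A k) / X k = X k.+1 - cotan (A k) / X k.+1;
  trav_turn : forall k, (k.+2 < N)%N ->
    A k.+1 * (1 - A k / X k.+1 ^+ 2) = A k + X k.+1 ^- 2;
  trav_rate : forall k, (k.+1 < N)%N ->
    let j := (minn k.+1 (N - k.+1))%:R in
    [/\ j * A k <= X k ^+ 2, j * A k <= X k.+1 ^+ 2,
        j / A k <= X k ^+ 2 & j / A k <= X k.+1 ^+ 2] }.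

(** Time reversal replaces [Theta] by [pi - Theta], that is [a] by [a^-1], and
exchanges the ends of a flight; flights and reflections are invariant under
it.  It is therefore enough to follow a symmetric sequence up to its middle. *)
Lemma palindrome (R : realType) N (X A : nat -> R) : (2 <= N)%N ->
  (forall k, (k < N)%N -> X (N.-1 - k)%N = X k) ->
  (forall k, (k.+1 < N)%N -> A (N.-2 - k)%N = (A k)^-1) ->
  (forall k, 11/10 <= X k) -> X 0 <= N.+1%:R -> A 0 = X 0 ^- 2 ->
  (forall k, 0 < A k) ->
  (forall k, (k.*2.+2 <= N)%N ->
    X k + cotan (A k) / X k = X k.+1 - cotan (A k) / X k.+1) ->
  (forall k, (k.*2.+3 <= N)%N ->
    A k.+1 * (1 - A k / X k.+1 ^+ 2) = A k + X k.+1 ^- 2) ->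
  (forall k, (k.*2.+2 <= N)%N ->
    [/\ A k <= 1, k.+1%:R <= A k * X k ^+ 2 & X k <= X k.+1]) ->
  traversal N X A.
Proof.
move=> N2 sX sA X1 XN A0 Ap fl tu ra; split=> //.
- have := sA 0 N2; have := sX 0 (ltnW N2); rewrite !subn0 => -> ->.
  by rewrite A0 invrK.
- move=> k kN; have [le|gt] := leqP k.*2.+2 N; first exact: fl.
  have := fl (N.-2 - k)%N; rewrite sA // cotanV.
  have -> : (N.-2 - k).+1 = (N.-1 - k)%N by lia.
  have -> : (N.-2 - k)%N = (N.-1 - k.+1)%N by lia.
  rewrite !sX //; last by lia.
  by rewrite !mulNr opprK => ->//; lia.
- move=> k kN; have [le|gt] := leqP k.*2.+3 N; first exact: tu.
  have := tu (N.-2 - k.+1)%N.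
  have -> : (N.-2 - k.+1).+1 = (N.-2 - k)%N by lia.
  rewrite !sA //; last by lia.
  have -> : (N.-2 - k)%N = (N.-1 - k.+1)%N by lia.
  rewrite sX //; last by lia.
  have hN : (((N.-2 - k.+1).*2).+3 <= N)%N by lia.
  move=> /(_ hN).
  have := Ap k; have := Ap k.+1; have := X1 k.+1.
  set x := X k.+1; set a := A k; set a' := A k.+1 => x1 a'0 a0.
  have x0 : x != 0 by rewrite gt_eqF //; lra.
  move=> e.
  have := congr1 (fun z => z * (a * a' * x ^+ 2)) e.
  have -> : a^-1 * (1 - a'^-1 / x ^+ 2) * (a * a' * x ^+ 2) = a' * x ^+ 2 - 1.
    by field; rewrite x0 !gt_eqF.
  have -> : (a'^-1 + x ^- 2) * (a * a' * x ^+ 2) = a * x ^+ 2 + a * a'.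
    by field; rewrite x0 !gt_eqF.
  move=> e'; apply: (@mulIf _ (x ^+ 2)); first by rewrite expf_neq0.
  rewrite mulrDl mulVf ?expf_neq0 // -mulrA mulrBl mul1r divfK ?expf_neq0 //.
  by lra.
- have half k : (k.*2.+2 <= N)%N -> let j := k.+1%:R in
    [/\ j * A k <= X k ^+ 2, j * A k <= X k.+1 ^+ 2,
        j / A k <= X k ^+ 2 & j / A k <= X k.+1 ^+ 2].
    move=> kN; have [h1 h2 h3] := ra _ kN.
    have a0 := Ap k; have x1 := X1 k.
    have XX : X k ^+ 2 <= X k.+1 ^+ 2 by rewrite ler_sqr ?nnegrE; lra.
    have c : k.+1%:R / A k <= X k ^+ 2 by rewrite ler_pdivrMr // mulrC.
    have d : k.+1%:R * A k <= X k ^+ 2.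
      have i1 : 1 <= (A k)^-1 by rewrite invf_ge1.
      by apply: le_trans c; apply: ler_wpM2l => //; lra.
    by split=> //; apply: le_trans XX.
  move=> k kN; have [le|gt] := leqP k.*2.+2 N.
    have -> : minn k.+1 (N - k.+1) = k.+1 by lia.
    exact: half.
  have -> : minn k.+1 (N - k.+1) = (N.-2 - k).+1 by lia.
  have := half (N.-2 - k)%N; rewrite sA //.
  have -> : X (N.-2 - k).+1 = X k.
    by rewrite -[RHS]sX; [congr X|]; lia.
  have -> : X (N.-2 - k)%N = X k.+1.
    by rewrite -[RHS]sX; [congr X|]; lia.
  by rewrite invrK => /(_ _)[|? ? ? ?]; [lia|split].
Qed.

(** For even [N] the middle flight is vertical, which means that the direction
[a = 1] is reached exactly, and for odd [N] the middle collision is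
perpendicular to the curve, which means that the directions before and after it
are inverse to each other. *)
Lemma traversal_exists (R : realType) N : (6 <= N)%N ->
  exists X A : nat -> R, traversal N X A.
Proof.
move=> N6.
(* [m + 2] collisions up to the middle one, or up to the vertical flight *)
pose m := (N.-1)./2.-1.
have [m0 mN1 mN2 mN3] : [/\ 0 < m, N <= m.*2 + 4, m.*2 + 3 <= N & m.*2 + 4 <> N -> N = m.*2 + 3]%N.
  by rewrite /m; split; lia.
(* cleared denominators of [(u + v) / (1 - u * v) = 1 / u], resp. [= 1] *)
pose psi (u v : R) := if odd N then u * u + 2 * (u * v) - 1 else u + v + u * v - 1.
have cpsi (u v : R -> R) x : {for x, continuous u} -> {for x, continuous v} ->
     {for x, continuous (fun x => psi (u x) (v x))}.
  move=> cu cv; rewrite /psi; case: (odd N).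
    apply: cvgB; last exact: cvg_cst.
    by apply: cvgD; [exact: cvgM | apply: cvgM; [exact: cvg_cst | exact: cvgM]].
  by apply: cvgB; [apply: cvgD; [exact: cvgD | exact: cvgM] | exact: cvg_cst].
have psi1 (v : R) : 0 < v -> 0 < psi 1 v by rewrite /psi; case: ifP => _; lra.
have psi0 (u v : R) : 0 < u <= 2^-1 -> 0 < v <= 4^-1 -> psi u v < 0.
  move=> /andP[u0 u1] /andP[v0 v1].
  have : u * u <= 2^-1 * 2^-1 by apply: ler_pM => //; exact: ltW.
  have : u * v <= 2^-1 * 4^-1 by apply: ler_pM => //; exact: ltW.
  by rewrite /psi; case: ifP => _; lra.
have [b [b1 bB e lt1]] := half_orbit_tune m0 cpsi psi1 psi0.
have b1' : 1 < b by lra.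
pose x k := (half_orbit b k).1; pose a k := (half_orbit b k).2.
have inv k : [/\ b <= x k, 0 < a k, a k <= 1 & x k <= x k.+1].
  by have [h1 /andP[h2 h3] h4] := half_orbit_inv k b1'.
pose X k := x (minn k (N.-1 - k)); pose A k := if (k.*2.+2 <= N)%N then a k else (a (N.-2 - k)%N)^-1.
have XE k : (k.*2 < N)%N -> X k = x k by move=> kN; rewrite /X; congr x; lia.
have am1 : ~~ odd N -> a m.+1 = 1.
  move=> eN; rewrite /a half_orbit_turn //; apply/min_idPl.
  have [xb a0 a1 _] := inv m.
  have [xb' _ _ _] := inv m.+1.
  have /andP[v0 v1] := expNr2_itv (lt_le_trans b1' xb').
  rewrite ler_pdivlMr; first by move: e; rewrite /psi (negPf eN); lra.
  by rewrite subr_gt0; nra.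
have turn k : (k < m)%N -> a k.+1 * (1 - a k / x k.+1 ^+ 2) = a k + x k.+1 ^- 2.
  by move=> km; apply: half_orbit_turn_lt1 => //; exact: lt1.
exists X, A; apply: palindrome.
- by lia.
- by move=> k kN; rewrite /X; congr x; lia.
- move=> k kN; rewrite /A.
  have [le|gt] := leqP k.*2.+2 N; last first.
    by rewrite ifT ?invrK //; lia.
  case: ifP => [le2|_]; last by congr (a _)^-1; lia.
  have -> : (N.-2 - k = m.+1)%N by lia.
  have -> : k = m.+1 by lia.
  by rewrite am1 ?invr1 //; lia.
- by move=> k; rewrite /X; have [? _ _ _] := inv (minn k (N.-1 - k)); lra.
- rewrite XE ?double0; last by lia.
  rewrite /x /=; apply: le_trans bB _.
  by rewrite -natrM ler_nat; lia.
- by rewrite XE /A ?double0 ?(leq_trans _ N6) //; lia.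
- move=> k; rewrite /A; case: ifP => _; have [_ h _ _] := inv k => //.
  by have [_ h' _ _] := inv (N.-2 - k)%N; rewrite invr_gt0.
- move=> k kN; rewrite /A kN XE; last by lia.
  have [E|ne] := eqVneq k.*2.+2 N.
    have ek : k = m.+1 by lia.
    have -> : X k.+1 = x k by rewrite /X; congr x; lia.
    rewrite ek am1; last by lia.
    by rewrite /cotan invr1 subrr !mul0r addr0 subr0.
  by rewrite XE; [exact: half_orbit_flight | lia].
- move=> k kN; rewrite XE; last by lia.
  have hk : (k.*2.+2 <= N)%N by lia.
  rewrite /A hk; move: kN; rewrite leq_eqVlt => /predU1P[E|kN]; last first.
    rewrite ifT //; have : (k <= m)%N by lia.
    rewrite leq_eqVlt => /predU1P[ek|]; last exact: turn.
    have eN : ~~ odd N by lia.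
    rewrite ek am1 //; move: e; rewrite /psi (negPf eN) mul1r -/(a m) -/(x m.+1) => e.
    by rewrite -[a m / x m.+1 ^+ 2]/(a m * x m.+1 ^- 2); lra.
  have ek : k = m by lia.
  rewrite ifF; last by lia.
  have -> : (N.-2 - k.+1)%N = m by lia.
  have oN : odd N by lia.
  move: e; rewrite ek /psi oN -/(a m) -/(x m.+1) => e.
  have [_ a0 _ _] := inv m; apply: (mulfI (lt0r_neq0 a0)); rewrite mulVKf ?gt_eqF //.
  by rewrite -[a m / x m.+1 ^+ 2]/(a m * x m.+1 ^- 2) mulrDr; lra.
- move=> k kN; rewrite /A kN XE; last by lia.
  have [xb a0 a1 xx] := inv k.
  split=> //.
    have [km|km] := leqP k m.
      by apply: half_orbit_ge => // i ik; apply: lt1; apply: leq_trans km.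
    have ek : k = m.+1 by lia.
    have eN : ~~ odd N by lia.
    rewrite ek am1 // mul1r.
    have := half_orbit_ge b1' lt1; rewrite -/(a m) -/(x m).
    have [h1 h2 h3 h4] := inv m; have [h1' _ _ _] := inv m.+1.
    move: e; rewrite /psi (negPf eN) -/(a m) -/(x m.+1) => e.
    have xm0 : 0 < x m.+1 by lra.
    have := congr1 (fun z => z * x m.+1 ^+ 2) e.
    rewrite mul0r !(mulrDl, mulNr, mul1r) -(mulrA (a m)) mulVf ?expf_neq0 ?gt_eqF // mulr1.
    have : a m * x m ^+ 2 <= a m * x m.+1 ^+ 2.
      by apply: ler_wpM2l; [exact: ltW | rewrite ler_sqr ?nnegrE; lra].
    by rewrite -[m.+2]addn1 natrD; lra.
  have [E|ne] := eqVneq k.*2.+2 N.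
    have -> : X k.+1 = x k by rewrite /X; congr x; lia.
    by [].
  by rewrite XE //; lia.
Qed.

(** * The boundary of the table and its arc length parameter *)

Lemma derive1_hyperbola (R : realType) (t : R) :
  0 <= t -> derive1 (hyperbola : R -> R) t = - (t + 1) ^- 2.
Proof.
move=> t0; rewrite derive1E.
have t1 : t + 1 != 0 by rewrite gt_eqF //; lra.
have d : is_derive t 1 (fun x : R => x + 1) 1.
  by have := is_deriveD (is_derive_id t 1) (is_derive_cst (1:R) t 1); rewrite addr0.
have := @is_deriveV R (fun x : R => x + 1) t 1 1 t1 d.
by move=> /(@derive_val _ _ _ _ _ _ _) ->; rewrite /GRing.scale /= mulr1.
Qed.

Definition speed (R : realType) (t : R) : R := Num.sqrt (1 + (derive1 hyperbola t) ^+ 2).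

Lemma speed_integrable (R : realType) (x y : R) : 0 <= x ->
  lebesgue_measure.-integrable `[x, y] (EFin \o @speed R).
Proof.
move=> x0.
suff : lebesgue_measure.-integrable `[x, y]
    (EFin \o (fun t : R => Num.sqrt (1 + (- (t + 1) ^- 2) ^+ 2))).
  apply: eq_integrable => // t; rewrite inE /= in_itv /= => /andP[xt _].
  by rewrite /speed derive1_hyperbola //; lra.
apply: continuous_compact_integrable; first exact: segment_compact.
apply: continuous_in_subspaceT => t; rewrite inE /= in_itv /= => /andP[xt _].
have t1 : t + 1 != 0 by rewrite gt_eqF //; lra.
have ci : {for t, continuous (fun t : R => - (t + 1) ^- 2)}.
  apply: cvgN; apply: cvgV; first by rewrite expf_neq0.
  have c1 : {for t, continuous (fun t : R => t + 1)}.
    by apply: cvgD; [exact: cvg_id | exact: cvg_cst].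
  exact: (cvgM c1 c1).
apply: (@cvg_comp _ _ _ _ Num.sqrt); last exact: sqrt_continuous.
by apply: cvgD; [exact: cvg_cst | exact: (cvgM ci ci)].
Qed.

Lemma arclength_lt (R : realType) (x y : R) : 0 <= x -> x < y ->
  arclength hyperbola x < arclength hyperbola y.
Proof.
move=> x0 xy; rewrite -subr_gt0 /arclength.
have int := @speed_integrable R 0 y (lexx _).
have bx : (BLeft (0:R) <= BRight x)%O by rewrite bnd_simp.
have by_ : (BRight x <= BRight y)%O by rewrite bnd_simp ltW.
rewrite -[X in _ < X - _]/(\int[lebesgue_measure]_(t in `[0, y]) speed t).
rewrite -[X in _ < _ - X]/(\int[lebesgue_measure]_(t in `[0, x]) speed t).
rewrite (Rintegral_itvB int bx by_).
apply: (@lt_le_trans _ _ (\int[lebesgue_measure]_(t in `]x, y]) 1)).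
  rewrite Rintegral_cst //= lebesgue_measure_itv /= lte_fin xy mul1r.
  by rewrite subr_gt0.
apply: le_Rintegral => //.
- suff : lebesgue_measure.-integrable `[x, y] (EFin \o (fun=> 1 : R)).
    by apply: integrableS => // t; rewrite /= !in_itv /= => /andP[/ltW -> ->].
  apply: continuous_compact_integrable; first exact: segment_compact.
  by apply: continuous_in_subspaceT => ? _; exact: cvg_cst.
- have := @speed_integrable R x y x0.
  by apply: integrableS => // t; rewrite /= !in_itv /= => /andP[/ltW -> ->].
- move=> t _; rewrite -{1}(@sqrtr1 R) ler_sqrt ?lerDl ?sqr_ge0 //.
  by rewrite addr_ge0 // sqr_ge0.
Qed.

Lemma arclength0 (R : realType) : arclength hyperbola (0 : R) = 0.
Proof. by rewrite /arclength set_itv1 Rintegral_set1. Qed.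

Lemma arclength_inj (R : realType) (x y : R) : 0 <= x -> 0 <= y ->
  arclength hyperbola x = arclength hyperbola y -> x = y.
Proof.
move=> x0 y0 e; have [] := ltgtP x y => // xy.
  by have := arclength_lt x0 xy; rewrite e ltxx.
by have := arclength_lt y0 xy; rewrite e ltxx.
Qed.

(** The value of the parameter [r] at the point of the curve of abscissa [x]. *)
Definition graph_r (R : realType) (x : R) : R := - arclength hyperbola x.

Lemma graph_r_lt0 (R : realType) (x : R) : 0 < x -> graph_r x < 0.
Proof.
by move=> x0; rewrite oppr_lt0 -(@arclength0 R); exact: arclength_lt.
Qed.

Lemma abscissa_graph_r (R : realType) (x : R) :
  0 <= x -> abscissa hyperbola (graph_r x) = x.
Proof.
move=> x0; apply: (@xget_unique R); first by rewrite /graph_r opprK.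
by move=> y [y0]; rewrite opprK => e; exact: arclength_inj.
Qed.

Lemma foot_graph_r (R : realType) (x : R) : 0 < x ->
  foot hyperbola (graph_r x) = (x, (x + 1)^-1).
Proof.
by move=> x0; rewrite /foot graph_r_lt0 // abscissa_graph_r // ltW.
Qed.

Lemma abscissa_ge0 (R : realType) (r : R) : 0 <= abscissa hyperbola r.
Proof. by rewrite /abscissa; case: xgetP => // x _ []. Qed.

(** Only the vertex has to be excluded: it would be the foot of any [r < 0] such
that [- r] is not an arc length. *)
Lemma foot_inj (R : realType) (r r' : R) :
  sides hyperbola r -> sides hyperbola r' -> foot hyperbola r = foot hyperbola r' ->
  foot hyperbola r <> (0, 1) -> r = r'.
Proof.
have f0 : hyperbola (0 : R) = 1 by rewrite add0r invr1.
have fV (x : R) : 0 <= x -> 1 - (x + 1)^-1 = x / (x + 1).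
  by move=> x0; field; rewrite gt_eqF //; lra.
have get (x : R) : x < 0 -> abscissa hyperbola x != 0 -> arclength hyperbola (abscissa hyperbola x) = - x.
  by move=> x0; rewrite /abscissa; case: xgetP => [y _ []//|_]; rewrite eqxx.
have neg (x : R) : x < 0 -> foot hyperbola x <> (0, 1) -> abscissa hyperbola x != 0.
  by move=> x0; rewrite /foot x0; case: eqP => // ->; rewrite f0.
move=> [r0|r0] [r'0|r'0] e nV.
- have a0 := neg _ r0 nV; have a0' := neg _ r'0; rewrite -e in a0'.
  apply: oppr_inj; rewrite -(get _ r0 a0) -(get _ r'0 (a0' nV)).
  by move: e; rewrite /foot r0 r'0 => -[->].
- have := neg _ r0 nV; move: e; rewrite /foot r0.
  by case: ltP => [|_ [->]]; [case/andP: r'0 => ? _; rewrite ltNge ltW | rewrite eqxx].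
- rewrite e in nV; have := neg _ r'0 nV; move: e; rewrite /foot r'0.
  by case: ltP => [|_ [<-]]; [case/andP: r0 => ? _; rewrite ltNge ltW | rewrite eqxx].
- move: e; rewrite /foot !ltNge; case/andP: r0 => /ltW -> _; case/andP: r'0 => /ltW -> _ /=.
  by case=> /addrI /oppr_inj.
Qed.

(** Points of the boundary are shown not to be interior by leaving the table in
the direction [- v]. *)
Lemma interior_ray (R : realType) (A : set (R * R)) (p v : R * R) :
  A° p -> exists2 e : R, 0 < e & A (p + (- e) *: v).
Proof.
move=> pA.
have c : {for (0 : R), continuous (fun e : R => p + (- e) *: v)}.
  apply: cvgD; first exact: cvg_cst.
  by apply: cvgZr_tmp; apply: cvgN; exact: cvg_id.
have : nbhs (0 : R) ((fun e : R => p + (- e) *: v) @^-1` A).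
  by apply: c; rewrite oppr0 scale0r addr0.
case/nbhs_ballP => e /= e0 sub; exists (e / 2); first by rewrite divr_gt0.
apply: sub; rewrite /ball /= sub0r normrN gtr0_norm ?divr_gt0 //; lra.
Qed.

Lemma interior_table (R : realType) (x y : R) : 0 < x -> 0 < y -> y * (x + 1) < 1 ->
  (table hyperbola)° (x, y).
Proof.
move=> x0 y0 xy.
have cx : {for (x, y), continuous (fun q : R * R => q.1)} by exact: cvg_fst.
have cy : {for (x, y), continuous (fun q : R * R => q.2)} by exact: cvg_snd.
have cxy : {for (x, y), continuous (fun q : R * R => q.2 * (q.1 + 1))}.
  by apply: cvgM => //; apply: cvgD => //; exact: cvg_cst.
rewrite /interior /=; near=> q.
have q1 : 0 < q.1 by near: q; exact: (cvgr_gt _ cx).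
have q2 : 0 < q.2 by near: q; exact: (cvgr_gt _ cy).
have q3 : q.2 * (q.1 + 1) < 1 by near: q; exact: (cvgr_lt _ cxy).
rewrite /table /=; split; first exact: ltW.
rewrite (ltW q2) /= -[leRHS]mul1r ler_pdivlMr; [exact: ltW | lra].
Unshelve. all: by end_near.
Qed.

Lemma free_flight_unique (R : realType) (f : R -> R) (q v q1 q2 : R * R) :
  free_flight f q v q1 -> free_flight f q v q2 -> q1 = q2.
Proof.
move=> [t1 [t10 -> in1 [_ nin1]]] [t2 [t20 -> in2 [_ nin2]]].
have [lt|lt|-> //] := ltgtP t1 t2.
  by exfalso; apply: nin1; apply: in2; rewrite t10.
by exfalso; apply: nin2; apply: in1; rewrite t20.
Qed.

Lemma foot_floor (R : realType) (r x : R) : 0 < x -> foot hyperbola r <> (x, 0).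
Proof.
move=> x0; rewrite /foot; case: ifP => _ [].
  move=> _ /eqP; rewrite invr_eq0 => /eqP e.
  by have := abscissa_ge0 r; lra.
by move=> e; lra.
Qed.

Lemma next_hit_unique (R : realType) (q v : R * R) r v' :
  next_hit hyperbola q v r v' -> foot hyperbola r <> (0, 1) ->
  forall r1 v1, next_hit hyperbola q v r1 v1 -> r1 = r /\ v1 = v'.
Proof.
elim=> {q v r v'} [q v r sr ff nV|q v x r v' x0 ff _ IH nV] r1 v1 h.
  inversion h; subst.
    have e : r = r1 by apply: foot_inj => //; exact: free_flight_unique ff _.
    by rewrite e.
  have := free_flight_unique ff H0 => e.
  by exfalso; apply: (foot_floor H e).
inversion h; subst.
  have e := free_flight_unique ff H0.
  by exfalso; apply: (@foot_floor _ r1 _ x0); rewrite -e.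
have [e] := free_flight_unique ff H0.
by apply: IH => //; rewrite e.
Qed.

(** * Flights and reflections as steps of the billiard map *)

Lemma pair_scaleE (R : realType) (a x y : R) : a *: ((x, y) : R * R) = (a * x, a * y).
Proof. by []. Qed.

Lemma pair_addE (R : realType) (x y z t : R) :
  ((x, y) : R * R) + (z, t) = (x + z, y + t).
Proof. by []. Qed.

Lemma pair_oppE (R : realType) (x y : R) : - ((x, y) : R * R) = (- x, - y).
Proof. by []. Qed.

Definition pairE := (pair_scaleE, pair_addE, pair_oppE).

Lemma normal_unit (R : realType) (f : R -> R) (r : R) :
  (normal f r).1 ^+ 2 + (normal f r).2 ^+ 2 = 1.
Proof.
rewrite /normal; case: ifP => _; last by rewrite /= expr1n expr0n addr0.
move: (derive1 _ _) => m; cbv zeta; have D : 0 < 1 + m ^+ 2 by have := sqr_ge0 m; lra.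
rewrite pairE /GRing.scale /= !exprMn !exprVn (sqr_sqrtr (ltW D)) -mulrDr sqrrN expr1n.
by rewrite (addrC _ 1) mulVf // gt_eqF.
Qed.

Lemma velocity_surj (R : realType) (f : R -> R) (r : R) (v : R * R) :
  v.1 ^+ 2 + v.2 ^+ 2 = 1 -> 0 < v.1 * (normal f r).1 + v.2 * (normal f r).2 ->
  exists2 phi, - (pi / 2) < phi < pi / 2 & velocity f (r, phi) = v.
Proof.
have := normal_unit f r; rewrite /velocity /tangent /=.
case: (normal f r) => n1 n2 /=; case: v => v1 v2 /= n v vn.
(* the component of [v] along the tangent, which is [sin phi] *)
pose s := v1 * n2 - v2 * n1.
have sc : s ^+ 2 + (v1 * n1 + v2 * n2) ^+ 2 = 1.
  rewrite -[RHS]mulr1 -{1}n -v /s; ring.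
have s1 : -1 < s < 1.
  have : 0 < (v1 * n1 + v2 * n2) ^+ 2 by rewrite exprn_gt0.
  by move=> h; apply/andP; split; nra.
have s1' : -1 <= s <= 1 by case/andP: s1 => *; apply/andP; split; exact: ltW.
have as1 : - (pi / 2) < asin s by apply: asin_gtNpi2; case/andP: s1 => -> /ltW ->.
have as2 : asin s < pi / 2 by apply: asin_ltpi2; case/andP: s1 => /ltW -> ->.
exists (asin s); first by rewrite as1.
rewrite cos_asin // asinK; last by rewrite in_itv.
have -> : 1 - s ^+ 2 = (v1 * n1 + v2 * n2) ^+ 2 by rewrite -sc; ring.
rewrite sqrtr_sqr gtr0_norm // !pairE /GRing.scale /=; congr pair.
  transitivity (v1 * (n1 ^+ 2 + n2 ^+ 2)); last by rewrite n mulr1.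
  by rewrite /s; ring.
transitivity (v2 * (n1 ^+ 2 + n2 ^+ 2)); last by rewrite n mulr1.
by rewrite /s; ring.
Qed.

Lemma velocity_inj (R : realType) (f : R -> R) (r phi psi : R) :
  - (pi / 2) < phi < pi / 2 -> - (pi / 2) < psi < pi / 2 ->
  velocity f (r, phi) = velocity f (r, psi) -> phi = psi.
Proof.
have := normal_unit f r; rewrite /velocity /tangent /=.
case: (normal f r) => n1 n2 /= n.
move=> /andP[p1 p2] /andP[s1 s2]; rewrite !pairE => -[e1 e2].
apply: sin_inj; rewrite ?in_itv /= ?ltW //.
move: e1 e2; rewrite /= => e1 e2.
have h t : sin t = (cos t * n1 + sin t * n2) * n2 - (cos t * n2 + sin t * - n1) * n1.
  by rewrite -[LHS]mulr1 -n; ring.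
by rewrite h e1 e2 -h.
Qed.

(** [T5] chooses a successor, so computing it requires that the successor is
unique: flights are deterministic, the foot determines [r] and the velocity
determines [phi]. *)
Lemma T5_eq (R : realType) (p : R * R) r (v : R * R) :
  M5 hyperbola p -> sides hyperbola r -> foot hyperbola r <> (0, 1) ->
  next_hit hyperbola (foot hyperbola p.1) (velocity hyperbola p) r v ->
  v.1 ^+ 2 + v.2 ^+ 2 = 1 ->
  0 < v.1 * (normal hyperbola r).1 + v.2 * (normal hyperbola r).2 ->
  exists p', [/\ T5 hyperbola p = Some p', M5 hyperbola p', p'.1 = r & velocity hyperbola p' = v].
Proof.
move=> Mp sr nV hit v1 vn.
have [phi phi2 ephi] := velocity_surj v1 vn.
exists (r, phi); split=> //.
apply: xget_unique; first by exists (r, phi) => //; split => //=; rewrite ephi.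
move=> _ [[r1 phi1] [_ [/= _ phi12] /= hit1] <-].
have [er ev] := next_hit_unique hit nV hit1.
by congr Some; rewrite er; congr pair; apply: (@velocity_inj _ hyperbola r); rewrite // ephi -er ev.
Qed.

(** The same parameter in terms of the shifted abscissa [X = x + 1], in which the
curve is [X * Y = 1]. *)
Definition curve_r (R : realType) (X : R) : R := graph_r (X - 1).

Lemma curve_r_lt0 (R : realType) (X : R) : 1 < X -> curve_r X < 0.
Proof. by move=> X1; apply: graph_r_lt0; rewrite subr_gt0. Qed.

Lemma foot_curve_r (R : realType) (X : R) :
  1 < X -> foot hyperbola (curve_r X) = (X - 1, X^-1).
Proof. by move=> X1; rewrite foot_graph_r ?subr_gt0 // subrK. Qed.

Lemma foot_curve_r_neqV (R : realType) (X : R) :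
  1 < X -> foot hyperbola (curve_r X) <> (0, 1).
Proof. by move=> X1; rewrite foot_curve_r // => -[] e _; lra. Qed.

Lemma normal_curve_r (R : realType) (X : R) : 1 < X ->
  normal hyperbola (curve_r X) = (Num.sqrt (1 + (- X ^- 2) ^+ 2))^-1 *: (- X ^- 2, -1).
Proof.
move=> X1; rewrite /normal curve_r_lt0 //; rewrite /curve_r abscissa_graph_r; last by lra.
by rewrite derive1_hyperbola ?subrK //; lra.
Qed.

Lemma normal_curve_r_gt0 (R : realType) (X : R) (v : R * R) : 1 < X ->
  0 < - (v.1 * X ^- 2 + v.2) ->
  0 < v.1 * (normal hyperbola (curve_r X)).1 + v.2 * (normal hyperbola (curve_r X)).2.
Proof.
move=> X1 h; rewrite normal_curve_r // !pairE /GRing.scale /=.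
have D : 0 < 1 + (- X ^- 2) ^+ 2 by have := sqr_ge0 (- X ^- 2); lra.
set s := _^-1; have s0 : 0 < s by rewrite invr_gt0 sqrtr_gt0.
have -> : v.1 * (s * - X ^- 2) + v.2 * (s * -1) = s * - (v.1 * X ^- 2 + v.2) by ring.
by rewrite mulr_gt0.
Qed.

(** The velocity is turned by twice the angle of slope [b] and then reflected
in the horizontal axis. *)
Lemma reflect_curve_r (R : realType) (X : R) (v : R * R) : 1 < X -> let b := X ^- 2 in
  reflect_velocity (normal hyperbola (curve_r X)) v =
  ((v.1 * (1 - b ^+ 2) - 2 * b * v.2) / (1 + b ^+ 2),
   - (v.2 * (1 - b ^+ 2) + 2 * b * v.1) / (1 + b ^+ 2)).
Proof.
move=> X1 b; case: v => v1 v2; rewrite /reflect_velocity normal_curve_r // -/b.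
have D : 0 < 1 + (- b) ^+ 2 by have := sqr_ge0 (- b); lra.
have := sqr_sqrtr (ltW D); set s := Num.sqrt _ => s2.
have s0 : s != 0 by apply: contraTneq D => e; rewrite -s2 e expr0n ltxx.
rewrite sqrrN in s2 D; have D0 : 1 + b ^+ 2 != 0 by rewrite gt_eqF.
rewrite !pairE /GRing.scale /=.
have i2 : s^-1 * s^-1 = (1 + b ^+ 2)^-1 by rewrite -s2 -invfM -expr2.
have e m : 2 * (v1 * (s^-1 * - b) + v2 * (s^-1 * -1)) * (s^-1 * m) =
   (s^-1 * s^-1) * (2 * (v1 * - b - v2) * m) by ring.
congr pair; rewrite e i2; field => //.
Qed.

Lemma reflect_norm (R : realType) (n v : R * R) : n.1 ^+ 2 + n.2 ^+ 2 = 1 ->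
  (reflect_velocity n v).1 ^+ 2 + (reflect_velocity n v).2 ^+ 2 = v.1 ^+ 2 + v.2 ^+ 2.
Proof.
case: n v => [n1' n2] [v1 v2] n1; rewrite /= in n1; rewrite /reflect_velocity !pairE /GRing.scale /=.
set d := v1 * n1' + v2 * n2.
have -> : (v1 - 2 * d * n1') ^+ 2 + (v2 - 2 * d * n2) ^+ 2 =
  v1 ^+ 2 + v2 ^+ 2 - 4 * d ^+ 2 + 4 * d ^+ 2 * (n1' ^+ 2 + n2 ^+ 2).
  by rewrite /d; ring.
by rewrite n1; ring.
Qed.

Lemma reflect_curve_r_gt0 (R : realType) (X : R) (v : R * R) : 1 < X ->
  0 < v.1 * X ^- 2 + v.2 -> let v' := reflect_velocity (normal hyperbola (curve_r X)) v in
  0 < v'.1 * (normal hyperbola (curve_r X)).1 + v'.2 * (normal hyperbola (curve_r X)).2.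
Proof.
move=> X1 h; apply: normal_curve_r_gt0 => //; rewrite reflect_curve_r //=.
set b := X ^- 2 in h *; have D : 0 < 1 + b ^+ 2 by have := sqr_ge0 b; lra.
have -> : - ((v.1 * (1 - b ^+ 2) - 2 * b * v.2) / (1 + b ^+ 2) * b +
   - (v.2 * (1 - b ^+ 2) + 2 * b * v.1) / (1 + b ^+ 2)) = v.1 * b + v.2.
  by field; rewrite gt_eqF.
by [].
Qed.

(** The region above the curve is convex, so a segment that goes down from a point
of the curve, below the tangent of slope [- X ^- 2], does not meet it again.
The point [s = 1] lies on the floor. By time reversal this also covers the
segments that end on the curve. *)
Lemma chord_interior (R : realType) (X c s : R) :
  1 < X -> 1 < X + c / X -> c < X ^+ 2 -> 0 < s < 1 ->
  (table hyperbola)° (X - 1 + s * (c / X), (1 - s) / X).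
Proof.
move=> X1 F1 cX /andP[s0 s1]; have X0 : 0 < X by lra.
apply: interior_table.
- have : 0 < s * (X + c / X - 1) by apply: mulr_gt0; lra.
  have : 0 < (1 - s) * (X - 1) by apply: mulr_gt0; lra.
  by lra.
- by rewrite divr_gt0 //; lra.
- have -> : (1 - s) / X * (X - 1 + s * (c / X) + 1) = (1 - s) * (1 + s * (c / X ^+ 2)).
    by field; rewrite gt_eqF.
  have : c / X ^+ 2 < 1 by rewrite ltr_pdivrMr ?mul1r // exprn_gt0.
  move: (c / _) => d d1; have : 0 < (1 - s) * s * (1 - d) by rewrite !mulr_gt0 //; lra.
  have : 0 < s ^+ 2 by rewrite exprn_gt0.
  by rewrite expr2; lra.
Qed.

Lemma floor_boundary (R : realType) (x : R) :
  0 <= x -> (table hyperbola `\` (table hyperbola)°) (x, 0).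
Proof.
move=> x0; split; first by rewrite /table /= lexx invr_ge0; split => //; lra.
move=> /(@interior_ray _ _ _ (0, 1)) [e e0] [_ /andP[h _]].
by move: h; rewrite !pairE /GRing.scale /=; lra.
Qed.

Lemma curve_boundary (R : realType) (X : R) :
  1 < X -> (table hyperbola `\` (table hyperbola)°) (X - 1, X^-1).
Proof.
move=> X1; have X0 : 0 < X^-1 by rewrite invr_gt0; lra.
split; first by rewrite /table /= subrK lexx (ltW X0); split => //; lra.
move=> /(@interior_ray _ _ _ (0, -1)) [e e0] [_ /andP[_ h]].
by move: h; rewrite !pairE /GRing.scale /= mulr0 addr0 subrK; lra.
Qed.

Lemma wall_boundary (R : realType) (y : R) :
  0 < y < 1 -> (table hyperbola `\` (table hyperbola)°) (0, y).
Proof.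
move=> /andP[y0 y1]; split; first by rewrite /table /= add0r invr1 (ltW y0) (ltW y1).
move=> /(@interior_ray _ _ _ (1, 0)) [e e0] [h _].
by move: h; rewrite !pairE /GRing.scale /=; lra.
Qed.

Definition leaves (R : realType) (X : R) (v p : R * R) : Prop :=
  [/\ M5 hyperbola p, p.1 = curve_r X & velocity hyperbola p = v].

(** One step of [T5] between two collisions with the curve: down to the floor at
abscissa [X + c / X = X' - c / X'], and up again.  The conditions on [c] say
that the curve is left and reached transversally from below. *)
Lemma T5_floor (R : realType) (X X' c q : R) (p : R * R) :
  1 < X -> 1 < X' -> 0 < q -> (q * c) ^+ 2 + q ^+ 2 = 1 ->
  X + c / X = X' - c / X' -> c < X ^+ 2 -> - c < X' ^+ 2 ->
  leaves X (q * c, - q) p ->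
  exists2 p', T5 hyperbola p = Some p' &
    leaves X' (reflect_velocity (normal hyperbola (curve_r X')) (q * c, q)) p'.
Proof.
move=> X1 X'1 q0 q1 e cX cX' [Mp rp vp].
have X0 : 0 < X by lra. have X'0 : 0 < X' by lra.
set F := X + c / X in e; have F1 : 1 < F.
  have [c0|c0] := leP 0 c; first by have := divr_ge0 c0 (ltW X0); rewrite /F; lra.
  have : 0 <= (- c) / X' by rewrite divr_ge0 ?ltW // oppr_gt0.
  by rewrite e mulNr; lra.
have hit : next_hit hyperbola (foot hyperbola p.1) (velocity hyperbola p) (curve_r X')
   (reflect_velocity (normal hyperbola (curve_r X')) (q * c, q)).
  rewrite rp vp foot_curve_r //; apply: (@hit_floor _ _ _ _ (F - 1)); first by lra.
    exists (q * X)^-1; split.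
    - by rewrite invr_gt0 mulr_gt0.
    - rewrite !pairE /GRing.scale /= /F; congr pair; field; rewrite !gt_eqF //.
    - move=> s /andP[s0 s1].
      have -> : (X - 1, X^-1) + s *: (q * c, - q) =
        (X - 1 + (s * (q * X)) * (c / X), (1 - s * (q * X)) / X).
        by rewrite !pairE /GRing.scale /=; congr pair; field; rewrite gt_eqF.
      apply: chord_interior => //; rewrite !mulr_gt0 //=.
      by rewrite -ltr_pdivlMr ?mulr_gt0 // mul1r.
    - by apply: floor_boundary; lra.
  have -> : reflect_velocity (0, 1) (q * c, - q) = (q * c, q).
    by rewrite /reflect_velocity !pairE /GRing.scale /=; congr pair; ring.
  apply: hit_side; first by left; exact: curve_r_lt0.
  rewrite foot_curve_r //; exists (q * X')^-1; split.
  - by rewrite invr_gt0 mulr_gt0.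
  - by rewrite !pairE /GRing.scale /= e; congr pair; field; rewrite !gt_eqF.
  - move=> s /andP[s0 s1].
    have -> : (F - 1, 0) + s *: (q * c, q) =
      (X' - 1 + (1 - s * (q * X')) * (- c / X'), (1 - (1 - s * (q * X'))) / X').
      by rewrite !pairE /GRing.scale /= e; congr pair; field; rewrite gt_eqF.
    have : s * (q * X') < 1 by rewrite -ltr_pdivlMr ?mulr_gt0 // mul1r.
    have : 0 < s * (q * X') by rewrite !mulr_gt0.
    move=> h1 h2; apply: chord_interior => //; last by lra.
    by rewrite mulNr -e.
  - exact: curve_boundary.
have [|||p' [T M r V]] := T5_eq Mp _ (foot_curve_r_neqV X'1) hit.
- by left; exact: curve_r_lt0.
- by rewrite reflect_norm ?normal_unit.
- apply: reflect_curve_r_gt0 => //=.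
  have -> : q * c / X' ^+ 2 + q = q * (X' ^+ 2 + c) / X' ^+ 2.
    by field; rewrite gt_eqF.
  by rewrite divr_gt0 ?exprn_gt0 // mulr_gt0 //; lra.
by exists p'.
Qed.

(** On the line that meets the curve at [X], the gap [1 / Y - line] factors as
[(X - Y) * (1 / (X * Y) + w)], which is positive for [Y < X] as soon as
[w > - X ^- 2]. *)
Lemma slanted_interior (R : realType) (X w y0 x : R) :
  1 < X -> - X ^- 2 < w -> 0 < y0 -> y0 + w * (X - 1) = X^-1 ->
  0 < x < X - 1 -> (table hyperbola)° (x, y0 + w * x).
Proof.
move=> X1 w0 y00 e /andP[x0 x1]; have X0 : 0 < X by lra.
apply: interior_table => //.
  have : 0 < (y0 + w * x) * (X - 1).
    have -> : (y0 + w * x) * (X - 1) = y0 * (X - 1 - x) + (y0 + w * (X - 1)) * x by ring.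
    rewrite e; apply: addr_gt0; first by apply: mulr_gt0 => //; lra.
    by rewrite mulr_gt0 ?invr_gt0.
  by rewrite pmulr_lgt0 //; lra.
have -> : y0 = X^-1 - w * (X - 1) by lra.
rewrite -subr_gt0.
have -> : 1 - (X^-1 - w * (X - 1) + w * x) * (x + 1) =
  (X - 1 - x) * (X^-1 + w * (x + 1)) by field; rewrite gt_eqF.
apply: mulr_gt0; first by lra.
have : - X ^- 2 * (x + 1) < w * (x + 1) by rewrite ltr_pM2r //; lra.
have : X ^- 2 * (x + 1) < X ^- 2 * X by rewrite ltr_pM2l ?invr_gt0 ?exprn_gt0 //; lra.
have -> : X ^- 2 * X = X^-1 by field; rewrite gt_eqF.
by lra.
Qed.

Lemma T5_from_wall (R : realType) (r X w q : R) (p : R * R) :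
  M5 hyperbola p -> p.1 = r -> 0 < r < 1 -> velocity hyperbola p = (q, q * w) -> 0 < q ->
  q ^+ 2 + (q * w) ^+ 2 = 1 ->
  1 < X -> - X ^- 2 < w -> 1 - r + w * (X - 1) = X^-1 ->
  exists2 p', T5 hyperbola p = Some p' &
    leaves X (reflect_velocity (normal hyperbola (curve_r X)) (q, q * w)) p'.
Proof.
move=> Mp rp /andP[r0 r1] vp q0 q1 X1 w0 e.
have hit : next_hit hyperbola (foot hyperbola p.1) (velocity hyperbola p) (curve_r X)
   (reflect_velocity (normal hyperbola (curve_r X)) (q, q * w)).
  rewrite vp rp; apply: hit_side; first by left; exact: curve_r_lt0.
  rewrite foot_curve_r // {1}/foot ltNge (ltW r0) /= add0r invr1.
  exists ((X - 1) / q); split.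
  - by rewrite divr_gt0 // subr_gt0.
  - by rewrite !pairE /GRing.scale /= -e; congr pair; field; rewrite gt_eqF.
  - move=> s /andP[s0 s1].
    have -> : (0, 1 - r) + s *: (q, q * w) = (s * q, 1 - r + w * (s * q)).
      by rewrite !pairE /GRing.scale /=; congr pair; ring.
    apply: (@slanted_interior _ X) => //; first by lra.
    by rewrite mulr_gt0 //= -ltr_pdivlMr.
  - exact: curve_boundary.
have [|||p' [T M rr V]] := T5_eq Mp _ (foot_curve_r_neqV X1) hit.
- by left; exact: curve_r_lt0.
- by rewrite reflect_norm ?normal_unit.
- apply: reflect_curve_r_gt0 => //=.
  have -> : q / X ^+ 2 + q * w = q * (w - - X ^- 2) by ring.
  by rewrite mulr_gt0 // subr_gt0.
by exists p'.
Qed.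

Lemma T5_to_wall (R : realType) (X w q y0 : R) (p : R * R) :
  leaves X (- q, - (q * w)) p -> 0 < q -> q ^+ 2 + (q * w) ^+ 2 = 1 ->
  1 < X -> - X ^- 2 < w -> 0 < y0 < 1 -> y0 + w * (X - 1) = X^-1 ->
  exists2 p', T5 hyperbola p = Some p' & 0 < p'.1 < 1 /\ M5 hyperbola p'.
Proof.
move=> [Mp rp vp] q0 q1 X1 w0 /andP[y00 y01] e.
have r01 : 0 < 1 - y0 < 1 by apply/andP; split; lra.
have sr : sides hyperbola (1 - y0) by right; rewrite add0r invr1.
have ft : foot hyperbola (1 - y0) = (0, y0).
  by rewrite /foot ltNge ltW /= ?add0r ?invr1 ?subKr //; lra.
have nr : normal hyperbola (1 - y0) = (1, 0) by rewrite /normal ltNge ltW //; lra.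
have hit : next_hit hyperbola (foot hyperbola p.1) (velocity hyperbola p) (1 - y0)
   (reflect_velocity (normal hyperbola (1 - y0)) (- q, - (q * w))).
  rewrite vp rp; apply: hit_side => //.
  rewrite foot_curve_r // ft.
  exists ((X - 1) / q); split.
  - by rewrite divr_gt0 // subr_gt0.
  - by rewrite !pairE /GRing.scale /= -e; congr pair; field; rewrite gt_eqF.
  - move=> s /andP[s0 s1].
    have -> : (X - 1, X^-1) + s *: (- q, - (q * w)) =
        (X - 1 - s * q, y0 + w * (X - 1 - s * q)).
      by rewrite -e !pairE /GRing.scale /=; congr pair; ring.
    apply: (@slanted_interior _ X) => //.
    have : 0 < s * q by rewrite mulr_gt0.
    have : s * q < X - 1 by rewrite -ltr_pdivlMr.
    by move=> *; apply/andP; split; lra.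
  - by apply: wall_boundary; rewrite y00.
have [|||p' [T M rr V]] := T5_eq Mp sr _ hit.
- by rewrite ft => -[]; lra.
- by rewrite reflect_norm ?normal_unit //= !sqrrN.
- rewrite nr /reflect_velocity !pairE /GRing.scale /=.
  by lra.
by exists p' => //; rewrite rr.
Qed.

(** * Orbits that follow a symmetric excursion *)

(** The velocity after a collision with the curve, at angle [Theta] below the
horizontal, where [sin Theta = q] and [a = tan (Theta / 2)]. *)
Definition heading (R : realType) (a : R) : R * R :=
  let q := 2 * a / (1 + a ^+ 2) in (q * cotan a, - q).

Lemma heading_unit (R : realType) (a : R) : 0 < a ->
  let q := 2 * a / (1 + a ^+ 2) in 0 < q /\ (q * cotan a) ^+ 2 + q ^+ 2 = 1.
Proof.
move=> a0; have D : 0 < 1 + a ^+ 2 by have := sqr_ge0 a; lra.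
split; first by rewrite divr_gt0 // mulr_gt0.
by rewrite /cotan; field; rewrite !gt_eqF.
Qed.

Lemma T5_bounce (R : realType) (X X' a a' : R) (p : R * R) :
  1 < X -> 1 < X' -> 0 < a -> 0 < a' ->
  X + cotan a / X = X' - cotan a / X' ->
  `|cotan a| < X ^+ 2 -> `|cotan a| < X' ^+ 2 ->
  a' * (1 - a / X' ^+ 2) = a + X' ^- 2 ->
  leaves X (heading a) p ->
  exists2 p', T5 hyperbola p = Some p' & leaves X' (heading a') p'.
Proof.
move=> X1 X'1 a0 a'0 e /ltr_normlP[_ cX] /ltr_normlP[cX' _] e' Lp.
have [q0 q1] := heading_unit a0.
have [p' T L] := T5_floor X1 X'1 q0 q1 e cX cX' Lp.
exists p' => //; move: L; rewrite reflect_curve_r //=.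
have X'0 : 0 < X' ^- 2 by rewrite invr_gt0 exprn_gt0 //; lra.
move: e'; rewrite -[a / X' ^+ 2]/(a * X' ^- 2); move: (X' ^- 2) X'0 => b b0 e'.
suff -> : ((2 * a / (1 + a ^+ 2) * cotan a * (1 - b ^+ 2) -
       2 * b * (2 * a / (1 + a ^+ 2))) / (1 + b ^+ 2),
      - (2 * a / (1 + a ^+ 2) * (1 - b ^+ 2) +
         2 * b * (2 * a / (1 + a ^+ 2) * cotan a)) / (1 + b ^+ 2)) = heading a' by [].
have E : a' = (a + b) / (1 - a * b).
  have D : 1 - a * b != 0 by apply/eqP => D; move: e'; rewrite D mulr0; lra.
  by rewrite -e' mulfK.
have D : 1 - a * b != 0 by apply/eqP => D; move: e'; rewrite D mulr0; lra.
have Da : 0 < 1 + a ^+ 2 by have := sqr_ge0 a; lra.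
have Db : 0 < 1 + b ^+ 2 by have := sqr_ge0 b; lra.
have ab : 0 < a + b by lra.
have Dab : 0 < (1 - a * b) ^+ 2 + (a + b) ^+ 2.
  by apply: ltr_wpDl; [exact: sqr_ge0 | rewrite exprn_gt0].
rewrite /heading E /cotan; congr pair; field; rewrite ?(gt_eqF Da) ?(gt_eqF Db) ?(gt_eqF Dab) ?(gt_eqF ab) ?(gt_eqF a0) ?D //.
Qed.

Lemma cotan_near (R : realFieldType) (X x a t : R) :
  0 < X -> 0 < a -> a <= X ^+ 2 -> a^-1 <= X ^+ 2 ->
  `|x - X| <= 100^-1 * X -> `|t - a| <= 100^-1 * a -> `|cotan t| < x ^+ 2.
Proof.
move=> X0 a0 h1 h2 hx ht.
have E01 : 0 <= (100^-1 : R) <= 100^-1 by rewrite lexx invr_ge0 ler0n.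
have [_ ct _] := cotan_perturb a0 h1 h2 E01 ht.
apply: le_lt_trans ct _.
have xl : 99/100 * X <= x by move: hx; rewrite ler_norml => /andP[? ?]; lra.
have : (99/100 * X) ^+ 2 <= x ^+ 2 by apply: lerXn2r; rewrite ?nnegrE; lra.
have : 0 < X ^+ 2 by rewrite exprn_gt0.
by rewrite exprMn expr2; lra.
Qed.

(** The quotient of two consecutive terms is the product of [1 + 1 / k.+1] and
[1 + 1 / (N - k.+1)].  Hence a power of this sequence dominates the products of
the growth factors on both halves of the excursion at once. *)
Definition spread (R : realType) (N k : nat) : R := k.+1%:R / (N - k)%:R.

Lemma spread_gt0 (R : realType) (N k : nat) : (k < N)%N -> 0 < spread R N k.
Proof. by move=> kN; rewrite divr_gt0 ?ltr0n // subn_gt0. Qed.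

Lemma spread_le (R : realType) (N k : nat) : (k < N)%N -> spread R N k <= N%:R.
Proof.
move=> kN; rewrite ler_pdivrMr ?ltr0n ?subn_gt0 // -natrM ler_nat.
by rewrite (leq_trans kN) // leq_pmulr // subn_gt0.
Qed.

Lemma bernoulli_inequality (R : realFieldType) (t : R) n : 0 <= t -> 1 + n%:R * t <= (1 + t) ^+ n.
Proof.
move=> t0; elim: n => [|n IH]; first by rewrite mul0r addr0 expr0.
have n0 : 0 <= n%:R * (t * t) by rewrite mulr_ge0 // mulr_ge0.
rewrite exprS -[n.+1]addn1 natrD.
have : (1 + t) * (1 + n%:R * t) <= (1 + t) * (1 + t) ^+ n by apply: ler_wpM2l => //; lra.
by lra.
Qed.

(** This is Bernoulli's inequality for whichever of the two factors of
[spread N k.+1 / spread N k] corresponds to the nearer end. *)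
Lemma spread_step (R : realType) (N k : nat) : (k.+1 < N)%N ->
  spread R N k ^+ 10 * (1 + 10 / (minn k.+1 (N - k.+1))%:R) <= spread R N k.+1 ^+ 10.
Proof.
move=> kN.
pose u : R := k.+1%:R^-1; pose v : R := (N - k.+1)%:R^-1.
have k0 : 0 < k.+1%:R :> R by rewrite ltr0n.
have m0 : 0 < (N - k.+1)%:R :> R by rewrite ltr0n subn_gt0.
have u0 : 0 < u by rewrite invr_gt0.
have v0 : 0 < v by rewrite invr_gt0.
have -> : spread R N k.+1 = spread R N k * ((1 + u) * (1 + v)).
  rewrite /spread (_ : (N - k = (N - k.+1).+1)%N); last by lia.
  rewrite /u /v -[k.+2]addn1 -[(N - k.+1).+1]addn1 !natrD.
  by field; rewrite !gt_eqF //; lra.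
rewrite [leRHS]exprMn; apply: ler_wpM2l.
  by rewrite exprn_ge0 // ltW // spread_gt0 // ltnW.
rewrite exprMn.
have bu := bernoulli_inequality 10 (ltW u0); have bv := bernoulli_inequality 10 (ltW v0).
have h : (minn k.+1 (N - k.+1))%:R^-1 <= Num.max u v.
  by rewrite /minn; case: ifP => _; rewrite le_max lexx ?orbT.
have pu : 1 <= (1 + u) ^+ 10 by lra.
have pv : 1 <= (1 + v) ^+ 10 by lra.
move: h; rewrite le_max => /orP[h|h].
  apply: (@le_trans _ _ ((1 + u) ^+ 10)); first by lra.
  by rewrite ler_peMr //; lra.
apply: (@le_trans _ _ ((1 + v) ^+ 10)); first by lra.
by rewrite ler_peMl //; lra.
Qed.

(** The admissible relative error: [tolerance N k k.+1] after the [k]-th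
reflection, and [tolerance N k k] on arrival at the [k]-th collision, so that
each flight and each reflection raises one of the two indices.  The constant
makes it at most [1 / 100] throughout. *)
Definition tolerance (R : realType) (N k l : nat) : R :=
  (100 * N%:R ^+ 20)^-1 * (spread R N k * spread R N l) ^+ 10.

Lemma tolerance_ge0 (R : realType) (N k l : nat) : (k < N)%N -> (l < N)%N ->
  0 < tolerance R N k l.
Proof.
move=> kN lN; have N0 : 0 < N%:R :> R by rewrite ltr0n; lia.
apply: mulr_gt0; first by rewrite invr_gt0 mulr_gt0 // exprn_gt0.
by rewrite exprn_gt0 // mulr_gt0 ?spread_gt0.
Qed.

Lemma tolerance_le (R : realType) (N k l : nat) : (k < N)%N -> (l < N)%N ->
  tolerance R N k l <= 100^-1.
Proof.
move=> kN lN; have N0 : 0 < N%:R :> R by rewrite ltr0n; lia.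
rewrite /tolerance invfM -mulrA ler_piMr // ler_pdivrMl ?exprn_gt0 // mulr1.
rewrite (_ : 20 = 2 * 10)%N // exprM; apply: lerXn2r; rewrite ?nnegrE.
- by rewrite mulr_ge0 // ltW // spread_gt0.
- by rewrite exprn_ge0 // ltW.
- by rewrite expr2; apply: ler_pM; rewrite ?spread_le // ltW // spread_gt0.
Qed.

Lemma toleranceC (R : realType) N k l : tolerance R N k l = tolerance R N l k.
Proof. by rewrite /tolerance (mulrC (spread _ _ _)). Qed.

Lemma tolerance_step (R : realType) (N k l : nat) : (k.+1 < N)%N -> (l < N)%N ->
  tolerance R N k l * (1 + 10 / (minn k.+1 (N - k.+1))%:R) <= tolerance R N k.+1 l.
Proof.
move=> kN lN; have N0 : 0 < N%:R :> R by rewrite ltr0n; lia.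
rewrite /tolerance -(mulrA _^-1); apply: ler_wpM2l.
  by rewrite invr_ge0 mulr_ge0 // exprn_ge0 // ltW.
rewrite (exprMn _ (spread R N k)) (exprMn _ (spread R N k.+1)) mulrAC; apply: ler_wpM2r; last exact: spread_step.
by rewrite exprn_ge0 // ltW // spread_gt0.
Qed.

Lemma tolerance_incr (R : realType) (N k l : nat) : (k.+1 < N)%N -> (l < N)%N ->
  tolerance R N k l <= tolerance R N k.+1 l.
Proof.
move=> kN lN; apply: le_trans (tolerance_step R kN lN).
by rewrite ler_peMr ?(ltW (tolerance_ge0 _ (ltnW kN) lN)) // lerDl mulr_ge0.
Qed.

Lemma shadow_flight (R : realType) (N k : nat) (X A : nat -> R) (x a : R) :
  traversal N X A -> (k.+1 < N)%N ->
  `|x - X k| <= tolerance R N k k.+1 * X k ->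
  `|a - A k| <= tolerance R N k k.+1 * A k ->
  [/\ 1 < x, 0 < a, `|cotan a| < x ^+ 2 &
  exists x', [/\ `|x' - X k.+1| <= tolerance R N k.+1 k.+1 * X k.+1,
    1 < x', x + cotan a / x = x' - cotan a / x' & `|cotan a| < x' ^+ 2]].
Proof.
move=> tr kN hx ha.
have [r1 r2 r3 r4] := trav_rate tr kN.
have X1 := trav_ge tr k; have X1' := trav_ge tr k.+1.
have a0 := trav_dir tr k.
set j : R := (minn k.+1 (N - k.+1))%:R in r1 r2 r3 r4.
have j1 : 1 <= j by rewrite ler1n; lia.
have j0 : 0 < j by lra.
have E0 := tolerance_ge0 R (ltnW kN) kN.
have E1 := tolerance_le R (ltnW kN) kN.
have weak (B D C : R) : 0 < C -> B <= D * C -> D <= 100^-1 -> B <= 100^-1 * C.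
  by move=> C0 h1 h2; apply: le_trans h1 _; apply: ler_wpM2r => //; exact: ltW.
have ha1 := weak _ _ _ a0 ha E1.
have Xk0 : 0 < X k by lra.
have Xk'0 : 0 < X k.+1 by lra.
have hx1 := weak _ _ _ Xk0 hx E1.
have A1 : A k <= j * A k by rewrite ler_peMl // ltW.
have A2 : (A k)^-1 <= j / A k by rewrite ler_peMl // invr_ge0 ltW.
have ct : `|cotan a| < x ^+ 2.
  by apply: cotan_near hx1 ha1 => //; [exact: le_trans r1 | exact: le_trans r3].
(* a single scale for both ends of the flight *)
pose Q := Num.min (X k ^+ 2) (X k.+1 ^+ 2).
have Q0 : 0 < Q by rewrite lt_min !exprn_gt0.
have Q1 : Q <= X k ^+ 2 by rewrite ge_min lexx.
have Q2 : Q <= X k.+1 ^+ 2 by rewrite ge_min lexx orbT.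
have k1 : 0 <= j^-1 <= 1 by rewrite invr_ge0 ltW //= invf_le1.
have q1 : A k <= j^-1 * Q by rewrite ler_pdivlMl // le_min r1.
have q2 : (A k)^-1 <= j^-1 * Q by rewrite ler_pdivlMl // le_min r3.
have st := tolerance_step R kN kN.
have tl := tolerance_le R kN kN.
have E'1 : tolerance R N k k.+1 * (1 + 10 * j^-1) <= 100^-1 by exact: le_trans st tl.
have [x' hx' ex'] := flight_stable Xk0 Xk'0 a0 Q0 Q1 Q2 k1 q1 q2
  (trav_flight tr kN) (ltW E0) erefl E'1 hx ha.
have hx2 : `|x' - X k.+1| <= tolerance R N k.+1 k.+1 * X k.+1.
  by apply: le_trans hx' _; apply: ler_wpM2r; [exact: ltW|].
have hx'1 : `|x' - X k.+1| <= 100^-1 * X k.+1 by exact: weak hx2 tl.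
move: (hx1) (ha1) (hx'1); rewrite !ler_norml => /andP[u1 u2] /andP[v1 v2] /andP[w1 w2].
split; [lra | lra | by [] |].
exists x'; split=> //; first by lra.
by apply: cotan_near hx'1 ha1 => //; [exact: le_trans r2 | exact: le_trans r4].
Qed.

Lemma shadow_turn (R : realType) (N k : nat) (X A : nat -> R) (x' a : R) :
  traversal N X A -> (k.+2 < N)%N ->
  `|x' - X k.+1| <= tolerance R N k.+1 k.+1 * X k.+1 ->
  `|a - A k| <= tolerance R N k k.+1 * A k ->
  exists2 a', `|a' - A k.+1| <= tolerance R N k.+1 k.+2 * A k.+1 &
    a' * (1 - a / x' ^+ 2) = a + x' ^- 2.
Proof.
move=> tr kN hx ha.
have kN' := ltnW kN; have kN'' := ltnW kN'.
have [r1 _ r3 _] := trav_rate tr kN.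
have X1' := trav_ge tr k.+1.
have a0 := trav_dir tr k; have a'0 := trav_dir tr k.+1.
set j : R := (minn k.+2 (N - k.+2))%:R in r1 r3.
have j1 : 1 <= j by rewrite ler1n; lia.
have j0 : 0 < j by lra.
have X0 : 0 < X k.+1 by lra.
have k1 : 0 <= j^-1 <= 1 by rewrite invr_ge0 ltW //= invf_le1.
have EE : 0 <= tolerance R N k k.+1 <= tolerance R N k.+1 k.+1.
  by rewrite ltW ?tolerance_ge0 //=; exact: tolerance_incr.
have h1 : A k.+1 / X k.+1 ^+ 2 <= j^-1.
  by rewrite ler_pdivrMr ?exprn_gt0 // ler_pdivlMl.
have h2 : (A k.+1 * X k.+1 ^+ 2)^-1 <= j^-1.
  rewrite lef_pV2 ?posrE ?mulr_gt0 ?exprn_gt0 //.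
  by rewrite mulrC -ler_pdivrMr.
have [a' ha' ea'] := turn_stable X0 a0 a'0 k1 EE (tolerance_le R kN' kN') h1 h2
  (trav_turn tr kN) hx ha.
exists a' => //; apply: le_trans ha' _; apply: ler_wpM2r; first exact: ltW.
by rewrite [leRHS]toleranceC; apply: tolerance_step.
Qed.

Lemma shadow (R : realType) (N k : nat) (X A : nat -> R) (x a : R) (p p0 : R * R) :
  traversal N X A -> (k.+1 < N)%N -> T5 hyperbola p = Some p0 ->
  leaves x (heading a) p0 ->
  `|x - X 0| <= tolerance R N 0 1 * X 0 ->
  `|a - A 0| <= tolerance R N 0 1 * A 0 ->
  exists x a pk, [/\ T5_iter hyperbola k.+1 p = Some pk, leaves x (heading a) pk,
    `|x - X k| <= tolerance R N k k.+1 * X k &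
    `|a - A k| <= tolerance R N k k.+1 * A k].
Proof.
move=> tr + Tp Lp hx0 ha0; elim: k => [|k IH] kN; first by exists x, a, p0.
have [{Lp hx0}x [{ha0}a [pk [Tk Lk hx ha]]]] := IH (ltnW kN).
have [x1 a0 c1 [x' [hx' x'1 e c2]]] := shadow_flight tr (ltnW kN) hx ha.
have [a' ha' e'] := shadow_turn tr kN hx' ha.
have a'0 : 0 < a'.
  have := trav_dir tr k.+1; have := tolerance_le R (ltnW kN) kN.
  by move: ha'; rewrite ler_norml => /andP[? _] ? ?; nra.
have [p' T L] := T5_bounce x1 x'1 a0 a'0 e c1 c2 e' Lk.
exists x', a', p'; split=> //.
  by rewrite -[LHS]/(obind (T5 hyperbola) (T5_iter hyperbola k.+1 p)) Tk.
apply: le_trans hx' _; apply: ler_wpM2r; first by have := trav_ge tr k.+1; lra.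
rewrite [leRHS]toleranceC; apply: tolerance_incr => //; exact: ltnW.
Qed.

(** * Leaving the cusp *)

(** When [t * b] is close to [1] the outgoing velocity is almost horizontal, and
its slope is a small fraction of the slope [b] of the curve. *)
Lemma exit_slope (R : realFieldType) (t b : R) : 0 < t -> 0 < b < 1 ->
  97/100 <= t * b <= 1031/1000 ->
  let D := (t + b) ^+ 2 - (1 - t * b) ^+ 2 in
  0 < D /\ `|2 * (t + b) * (1 - t * b) / D| <= b / 10.
Proof.
move=> t0 /andP[b0 b1] /andP[m1 m2] D.
have s0 : 97/100 < t + b by nra.
have m3 : (1 - t * b) ^+ 2 <= 1/1000.
  have -> : (1 - t * b) ^+ 2 = (1 - t * b) * (1 - t * b) by rewrite expr2.
  by nra.
have D1 : 99/100 * (t + b) ^+ 2 <= D by rewrite /D; nra.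
have D0 : 0 < D by apply: lt_le_trans D1; rewrite mulr_gt0 // exprn_gt0 //; lra.
split=> //; rewrite normrM normfV (gtr0_norm D0) ler_pdivrMr // normrM gtr0_norm; last by lra.
have h1 : `|1 - t * b| <= 31/1000 by rewrite ler_norml; apply/andP; split; lra.
have h2 : 2 * (t + b) * `|1 - t * b| <= 2 * (t + b) * (31/1000).
  by apply: ler_wpM2l => //; lra.
apply: le_trans h2 _.
have : b / 10 * (99/100 * (t + b) ^+ 2) <= b / 10 * D by apply: ler_wpM2l => //; lra.
apply: le_trans.
have : 97/100 * (t + b) <= b * (t + b) * (t + b).
  by apply: ler_wpM2r; [lra | nra].
by rewrite expr2; lra.
Qed.

Lemma exit_line (R : realFieldType) (x w : R) : 1 < x -> `|w| <= x ^- 2 / 10 ->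
  - x ^- 2 < w /\ 0 < x^-1 - w * (x - 1) < 1.
Proof.
move=> x1; have x0 : 0 < x by lra.
have i0 : 0 < x^-1 by rewrite invr_gt0.
have xi : x * x^-1 = 1 by rewrite divff // gt_eqF.
rewrite -exprVn expr2; move: (x^-1) i0 xi => i i0 xi.
rewrite ler_norml => /andP[w1 w2].
have i1 : i < 1 by nra.
have ii : 0 < i * i by rewrite mulr_gt0.
have xii : x * (i * i) = i by rewrite mulrA xi mul1r.
split; first by lra.
have f1 : w * (x - 1) <= i * i / 10 * (x - 1) by apply: ler_wpM2r => //; lra.
have f2 : 0 < (x - 1) * (i + w) by rewrite mulr_gt0 //; nra.
by apply/andP; split; lra.
Qed.

Lemma exit_near (R : realFieldType) (X x t : R) : 11/10 <= X ->
  `|x - X| <= 100^-1 * X -> `|t - X ^+ 2| <= 100^-1 * X ^+ 2 ->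
  97/100 <= t * x ^- 2 <= 1031/1000.
Proof.
move=> X1; rewrite !ler_norml => /andP[x1 x2] /andP[t1 t2].
have x0 : 0 < x by lra.
have w1 : (99/100 * X) ^+ 2 <= x ^+ 2 by rewrite ler_sqr ?nnegrE; lra.
have w2 : x ^+ 2 <= (101/100 * X) ^+ 2 by rewrite ler_sqr ?nnegrE; lra.
have X2 : 0 < X ^+ 2 by rewrite exprn_gt0 //; lra.
rewrite !exprMn in w1 w2.
rewrite ler_pdivlMr ?exprn_gt0 // ler_pdivrMr ?exprn_gt0 //.
move: (x ^+ 2) (X ^+ 2) w1 w2 X2 t1 t2 => y Y w1 w2 X2 t1 t2.
by rewrite !expr2 in w1 w2; apply/andP; split; lra.
Qed.

(** The outgoing velocity makes the angle [2 * arctan t + 2 * arctan b] with the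
horizontal; by the addition formulas [w] is the opposite of its tangent. *)
Lemma exit_velocity (R : realType) (t b : R) : 0 < t ->
  let D := (t + b) ^+ 2 - (1 - t * b) ^+ 2 in
  let w := 2 * (t + b) * (1 - t * b) / D in
  let q := 2 * t / (1 + t ^+ 2) in
  0 < D -> exists2 p, 0 < p /\ p ^+ 2 + (p * w) ^+ 2 = 1 &
  ((q * cotan t * (1 - b ^+ 2) - 2 * b * q) / (1 + b ^+ 2),
   - (q * (1 - b ^+ 2) + 2 * b * (q * cotan t)) / (1 + b ^+ 2)) = (- p, - (p * w)).
Proof.
move=> t0 D w q D0.
have Dt : 0 < 1 + t ^+ 2 by have := sqr_ge0 t; lra.
have Db : 0 < 1 + b ^+ 2 by have := sqr_ge0 b; lra.
pose p := D / ((1 + t ^+ 2) * (1 + b ^+ 2)).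
have pw : p * w = 2 * (t + b) * (1 - t * b) / ((1 + t ^+ 2) * (1 + b ^+ 2)).
  by rewrite /p /w mulrC mulrA divfK // gt_eqF.
exists p.
  split; first by rewrite divr_gt0 // mulr_gt0.
  by rewrite pw /p /D; field; rewrite !gt_eqF.
by rewrite pw /p /D /q /cotan; congr pair; field; rewrite !gt_eqF.
Qed.

(** The reference orbit leaves the last collision horizontally; the orbits that
follow it leave with a small slope, and reach the wall strictly between its
ends without meeting the floor. *)
Lemma shadow_exit (R : realType) (N : nat) (X A : nat -> R) (x a : R) (pk : R * R) :
  traversal N.+2 X A -> leaves x (heading a) pk ->
  `|x - X N| <= tolerance R N.+2 N N.+1 * X N ->
  `|a - A N| <= tolerance R N.+2 N N.+1 * A N ->
  exists p1 p2, [/\ T5 hyperbola pk = Some p1, T5 hyperbola p1 = Some p2, 0 < p2.1 < 1 & M5 hyperbola p2].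
Proof.
move=> tr Lp hx ha.
have [x1 a0 c1 [x' [hx' x'1 e c2]]] := shadow_flight tr (ltnSn _) hx ha.
have [q0 q1] := heading_unit a0.
move: c1 c2 => /ltr_normlP[_ c1] /ltr_normlP[c2 _].
have [p1 T1] := T5_floor x1 x'1 q0 q1 e c1 c2 Lp.
rewrite reflect_curve_r //=.
have X1 := trav_ge tr N.+1; have A1 := trav_last tr; rewrite /= in A1.
have near : 97/100 <= a * x' ^- 2 <= 1031/1000.
  apply: (exit_near X1).
    apply: le_trans hx' _; apply: ler_wpM2r; last exact: tolerance_le.
    exact: le_trans X1.
  rewrite -A1; apply: le_trans ha _; apply: ler_wpM2r; last exact: tolerance_le.
  exact: ltW (trav_dir tr N).
have [D0 hw] := exit_slope a0 (expNr2_itv x'1) near.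
have [p [p0 pw] ->] := exit_velocity a0 D0.
have [wb y01] := exit_line x'1 hw.
move=> L1.
have [p2 T2 [? ?]] := T5_to_wall L1 p0 pw x'1 wb y01 (subrK _ _).
by exists p1, p2.
Qed.

(** * Entering the cusp *)

Lemma entry_bracket (R : realFieldType) (X y0 w e : R) : 1 < X -> 0 < e <= 100^-1 ->
  `|y0 - X^-1| <= e / 4 * X^-1 -> `|w| <= e / 8 * X ^- 2 ->
  y0 + w * (X * (1 - e) - 1) <= (X * (1 - e))^-1 /\
  (X * (1 + e))^-1 <= y0 + w * (X * (1 + e) - 1).
Proof.
move=> X1 /andP[e0 e1] hy hw; have X0 : 0 < X by lra.
have i0 : 0 < X^-1 by rewrite invr_gt0.
have xi : X * X^-1 = 1 by rewrite divff // gt_eqF.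
move: hw hy; rewrite -exprVn expr2 !invfM; move: (X^-1) i0 xi => i i0 xi hw.
have W u : 0 < u <= 1 + e -> `|w * (X * u - 1)| <= e * i / 4.
  move=> /andP[u0 u1]; have b : `|X * u - 1| <= 2 * X.
    by rewrite ler_norml; apply/andP; split; nra.
  have : `|w| * `|X * u - 1| <= e / 8 * (i * i) * (2 * X) by apply: ler_pM.
  have -> : e / 8 * (i * i) * (2 * X) = e / 4 * i * (X * i) by field.
  by rewrite normrM xi; lra.
have i1 : 1 + e <= (1 - e)^-1.
  by rewrite -[leRHS]mul1r ler_pdivlMr; nra.
have i2 : (1 + e)^-1 <= 1 - 9/10 * e.
  by rewrite -[leLHS]mul1r ler_pdivrMr; nra.
have j1 : i * (1 + e) <= i * (1 - e)^-1 by apply: ler_wpM2l => //; exact: ltW.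
have j2 : i * (1 + e)^-1 <= i * (1 - 9/10 * e) by apply: ler_wpM2l => //; exact: ltW.
have ei : 0 < e * i by rewrite mulr_gt0.
rewrite ler_norml => /andP[y1 y2].
split.
  have : `|w * (X * (1 - e) - 1)| <= e * i / 4 by apply: W; lra.
  by rewrite ler_norml => /andP[? ?]; lra.
have E2 : 0 <= e * e by rewrite mulr_ge0 // ltW.
have : `|w * (X * (1 + e) - 1)| <= e * i / 4 by apply: W; lra.
by rewrite ler_norml => /andP[? ?]; lra.
Qed.

Lemma entry_hit (R : realType) (X y0 w e : R) : 1 < X -> 0 < e <= 100^-1 ->
  `|y0 - X^-1| <= e / 4 * X^-1 -> `|w| <= e / 8 * X ^- 2 ->
  exists2 x, `|x - X| <= e * X & y0 + w * (x - 1) = x^-1.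
Proof.
move=> X1 e01 hy hw; have [lo hi] := entry_bracket X1 e01 hy hw.
case/andP: e01 => e0 e1.
pose g x := y0 + w * (x - 1) - x^-1.
have le1 : X * (1 - e) <= X * (1 + e) by nra.
have lo0 : 0 < X * (1 - e) by nra.
have cg : {within `[X * (1 - e), X * (1 + e)], continuous g}.
  apply: continuous_in_subspaceT => y; rewrite inE /= in_itv /= => /andP[y1 y2].
  have y0' : y != 0 by rewrite gt_eqF //; lra.
  apply: cvgB; last by apply: cvgV => //; exact: cvg_id.
  apply: cvgD; first exact: cvg_cst.
  apply: cvgM; first exact: cvg_cst.
  by apply: cvgB; [exact: cvg_id | exact: cvg_cst].
have glo : g (X * (1 - e)) <= 0 by rewrite subr_le0.
have ghi : 0 <= g (X * (1 + e)) by rewrite subr_ge0.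
have [|c] := @IVT _ g _ _ 0 le1 cg; first by rewrite ge_min le_max glo ghi orbT.
rewrite in_itv /= => /andP[c1 c2] /eqP; rewrite subr_eq0 => /eqP gc; exists c => //.
by rewrite ler_norml; apply/andP; split; lra.
Qed.

(** The half-angle formula [tan (Theta / 2) = sin Theta / (1 + cos Theta)], for
[S = s * sin Theta] and [C = s * cos Theta]. *)
Lemma heading_of (R : realFieldType) (s S C : R) : 0 < s -> 0 < S -> 0 < s + C ->
  S ^+ 2 + C ^+ 2 = s ^+ 2 -> let a := S / (s + C) in
  2 * a / (1 + a ^+ 2) = S / s /\ 2 * a / (1 + a ^+ 2) * cotan a = C / s.
Proof.
move=> s0 S0 D0 e a; set D := s + C in D0 a *.
have K : D ^+ 2 + S ^+ 2 = 2 * s * D.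
  have -> : D ^+ 2 + S ^+ 2 = s ^+ 2 + 2 * s * C + (S ^+ 2 + C ^+ 2) by rewrite /D; ring.
  by rewrite e /D; ring.
have a1 : 1 + a ^+ 2 = 2 * s / D.
  have -> : 1 + a ^+ 2 = (D ^+ 2 + S ^+ 2) / D ^+ 2 by rewrite /a; field; rewrite gt_eqF.
  by rewrite K; field; rewrite gt_eqF.
have qE : 2 * a / (1 + a ^+ 2) = S / s.
  by rewrite a1 /a; field; rewrite !gt_eqF.
split=> //; rewrite qE.
have -> : S / s * cotan a = (2 * D ^+ 2 - (D ^+ 2 + S ^+ 2)) / (2 * s * D).
  by rewrite /cotan /a; field; rewrite !gt_eqF.
by rewrite K (_ : C = D - s) ?/D; [field; rewrite !gt_eqF | ring].
Qed.

(** A velocity of slope [w] that is small compared with the slope [b] of the curve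
is reflected almost as a horizontal one, for which [a = b]. *)
Lemma entry_velocity (R : realFieldType) (b w q e : R) : 0 < b <= 9/10 -> 0 <= e <= 1 ->
  0 < q -> q ^+ 2 + (q * w) ^+ 2 = 1 -> `|w| <= e / 60 * b ->
  exists2 a, `|a - b| <= e / 20 * b &
  ((q * (1 - b ^+ 2) - 2 * b * (q * w)) / (1 + b ^+ 2),
   - (q * w * (1 - b ^+ 2) + 2 * b * q) / (1 + b ^+ 2)) =
  (2 * a / (1 + a ^+ 2) * cotan a, - (2 * a / (1 + a ^+ 2))).
Proof.
move=> /andP[b0 b1] /andP[e0 e1] q0 qw hw.
move: (hw); rewrite ler_norml => /andP[w1 w2].
have eb : 0 <= e * b by rewrite mulr_ge0 // ltW.
have eb1 : e * b <= b by rewrite ler_piMl // ltW.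
have q1 : q <= 1.
  rewrite -(@ler_sqr _ q 1) ?nnegrE ?(ltW q0) // expr1n.
  by have := sqr_ge0 (q * w); lra.
have q2 : 1 - q <= w ^+ 2.
  have : q ^+ 2 <= q by rewrite expr2 ler_piMl // ltW.
  have : (q * w) ^+ 2 <= w ^+ 2.
    rewrite exprMn ler_piMl ?sqr_ge0 // exprn_ile1 //; exact: ltW.
  by lra.
have w3 : w ^+ 2 <= e / 60 * b.
  apply: le_trans hw; rewrite -[w ^+ 2]ger0_norm ?sqr_ge0 // normrX expr2.
  rewrite ler_piMl // ler_norml; apply/andP; split; lra.
have b2 : b ^+ 2 + 2 * b * w <= 1.
  have h1 : b * b <= 9/10 * (9/10) by apply: ler_pM; lra.
  have h2 : b * w <= 9/10 * (1/60) by apply: le_trans (_ : b * (1/60) <= _); [apply: ler_wpM2l|]; lra.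
  by rewrite expr2; lra.
have s0 : 0 < 1 + b ^+ 2 by have := sqr_ge0 b; lra.
have C0 : 0 <= q * (1 - b ^+ 2 - 2 * b * w) by rewrite mulr_ge0 ?(ltW q0) //; lra.
have bb : 0 <= b ^+ 2 by rewrite sqr_ge0.
have S0 : 0 < q * (w * (1 - b ^+ 2) + 2 * b).
  rewrite mulr_gt0 //; have : - (e / 60 * b) * 1 <= w * (1 - b ^+ 2).
    have : `|w| * (1 - b ^+ 2) <= e / 60 * b * 1 by apply: ler_pM => //; rewrite ?expr2; nra.
    have : - `|w| * (1 - b ^+ 2) <= w * (1 - b ^+ 2).
      apply: ler_wpM2r; first by rewrite expr2; nra.
      by rewrite lerNl; have := ler_norm (- w); rewrite normrN.
    by lra.
  by lra.
have D0 : 0 < 1 + b ^+ 2 + q * (1 - b ^+ 2 - 2 * b * w) by lra.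
have [|qE cE] := heading_of s0 S0 D0.
  have -> : (q * (w * (1 - b ^+ 2) + 2 * b)) ^+ 2 + (q * (1 - b ^+ 2 - 2 * b * w)) ^+ 2 =
    (q ^+ 2 + (q * w) ^+ 2) * (1 + b ^+ 2) ^+ 2 by ring.
  by rewrite qw mul1r.
exists (q * (w * (1 - b ^+ 2) + 2 * b) / (1 + b ^+ 2 + q * (1 - b ^+ 2 - 2 * b * w)));
  last first.
  by rewrite cE qE; congr pair; [congr (_ / _); ring | rewrite mulNr; congr (- (_ / _)); ring].
set D := _ + _ in D0 *.
have -> : q * (w * (1 - b ^+ 2) + 2 * b) / D - b =
   ((1 + b ^+ 2) / D) * (q * w - (1 - q) * b) by rewrite /D; field; rewrite gt_eqF.
have r1 : 0 <= (1 + b ^+ 2) / D <= 1.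
  rewrite (divr_ge0 (ltW s0) (ltW D0)) /=.
  by rewrite ler_pdivrMr // mul1r /D lerDl.
case/andP: r1 => r0 r1; rewrite normrM (ger0_norm r0).
apply: (@le_trans _ _ `|q * w - (1 - q) * b|); first by rewrite ler_piMl.
have n1 : `|q * w| <= e / 60 * b.
  by rewrite normrM (gtr0_norm q0); apply: le_trans hw; rewrite ler_piMl.
have n2 : `|(1 - q) * b| <= e / 60 * b.
  rewrite normrM (gtr0_norm b0) ger0_norm ?subr_ge0 //.
  apply: ler_wpM2r; first exact: ltW.
  have : e * b <= e by rewrite ler_piMr //; lra.
  by lra.
by apply: le_trans (ler_normB _ _) _; lra.
Qed.

Lemma normr_sin_le (R : realType) (x : R) : `|sin x| <= `|x|.
Proof.
wlog x0 : x / 0 <= x => [H|].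
  have [|/ltW x0] := leP 0 x; first exact: H.
  by rewrite -normrN -sinN -(normrN x); apply: H; rewrite oppr_ge0.
have [|c _] := @MVT_segment R sin cos 0 x x0 (fun y _ => is_derive_sin y).
  by apply: continuous_subspaceT => y; exact: continuous_sin.
rewrite sin0 !subr0 => ->; rewrite normrM ler_piMl //.
exact: cos_max.
Qed.

Lemma small_angle (R : realType) (x : R) : `|x| <= 2^-1 ->
  [/\ - (pi / 2) < x < pi / 2, 2^-1 <= cos x & `|sin x / cos x| <= 2 * `|x|].
Proof.
move=> x1; have p2 := pihalf_ge1 R.
have xpi : - (pi / 2) < x < pi / 2.
  by move: x1; rewrite ler_norml => /andP[? ?]; apply/andP; split; lra.
have c0 := cos_gt0_pihalf xpi.
have c1 : 2^-1 <= cos x.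
  have s1 := le_trans (normr_sin_le x) x1.
  rewrite leNgt; apply/negP => c2.
  have : sin x ^+ 2 <= 2^-1 * 2^-1.
    by rewrite -real_normK ?num_real // expr2; apply: ler_pM.
  have : cos x * cos x <= 2^-1 * 2^-1 by apply: ler_pM; exact: ltW.
  by have := cos2Dsin2 x; rewrite (expr2 (cos x)); lra.
split=> //; rewrite normrM normfV (gtr0_norm c0) ler_pdivrMr //.
apply: le_trans (normr_sin_le x) _.
have : 2 * `|x| * 2^-1 <= 2 * `|x| * cos x by apply: ler_wpM2l => //; rewrite mulr_ge0.
by lra.
Qed.

Lemma tolerance_first (R : realType) (N : nat) : (2 <= N)%N ->
  (100 * N%:R ^+ 40)^-1 <= tolerance R N 0 1.
Proof.
move=> N2; have N0 : 0 < N%:R :> R by rewrite ltr0n; lia.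
have N1 : 0 < (N - 1)%:R :> R by rewrite ltr0n; lia.
have N10 : 0 < N%:R ^+ 20 :> R by rewrite exprn_gt0.
rewrite /tolerance (_ : 40 = 20 + 20)%N // exprD mulrA invfM.
apply: ler_wpM2l; first by rewrite invr_ge0 mulr_ge0 // ltW.
rewrite (_ : 20 = 2 * 10)%N // exprM -exprVn; apply: lerXn2r; rewrite ?nnegrE.
- by rewrite invr_ge0 exprn_ge0 // ltW.
- by rewrite mulr_ge0 // ltW // spread_gt0 //; lia.
- have iN : 0 <= N%:R^-1 :> R by rewrite invr_ge0 ltW.
  rewrite -exprVn expr2; apply: ler_pM => //; rewrite /spread ?subn0 ?mul1r //.
  rewrite ler_pdivlMr // mulrC ler_pdivrMr // -natrM ler_nat; lia.
Qed.

(** The exponent is [40 + 2]: the smallest tolerance is of order [N ^- 40], and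
the slope at the entrance has to be at most this fraction of [X 0 ^- 2], where
[X 0 <= n]. *)
Definition box_radius (R : realType) (n : nat) : R := (200 * 100 * n%:R ^+ 42)^-1.

Lemma box_radius_le (R : realType) (n : nat) (X E : R) : (0 < n)%N ->
  1 < X <= n%:R -> (100 * n%:R ^+ 40)^-1 <= E <= 1 ->
  [/\ 0 < box_radius R n, box_radius R n <= E / 200 * X ^- 2,
      box_radius R n <= E / 200 * X^-1 & box_radius R n < 100^-1 / 200 * X^-1].
Proof.
move=> n0 /andP[X1 Xn] /andP[En E1].
have n1 : 0 < n%:R :> R by rewrite ltr0n.
have n40 : 0 < n%:R ^+ 40 :> R by rewrite exprn_gt0.
have e0 : 0 < (100 * n%:R ^+ 40)^-1 :> R by rewrite invr_gt0 mulr_gt0.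
have k0 : 0 < 200 :> R by rewrite ltr0n.
have X0 : 0 < X by lra.
have i0 : 0 < X^-1 by rewrite invr_gt0.
have iX : n%:R^-1 <= X^-1 by rewrite lef_pV2.
have iX1 : X^-1 < 1 by rewrite invf_lt1.
have j0 : 0 <= n%:R^-1 :> R by rewrite invr_ge0 ltW.
have iX2 : n%:R ^- 2 <= X ^- 2.
  by rewrite -!exprVn; apply: lerXn2r; rewrite ?nnegrE // ltW.
have iXX : X ^- 2 < X^-1 by rewrite -exprVn expr2 gtr_pMr.
have rE : box_radius R n = (100 * n%:R ^+ 40)^-1 / 200 * n%:R ^- 2.
  rewrite /box_radius (exprD _ 40 2).
  move: (n%:R ^+ 40) (n%:R ^+ 2) n40 (exprn_gt0 2 n1) => u v u0 v0.
  by field; rewrite !gt_eqF.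
have r0 : 0 < box_radius R n.
  by rewrite rE; apply: mulr_gt0; [exact: divr_gt0 | rewrite invr_gt0 exprn_gt0].
have E0 : 0 < E by apply: lt_le_trans En.
have c0 : 0 <= (100 * n%:R ^+ 40)^-1 / 200 :> R by apply: divr_ge0; exact: ltW.
have v0 : 0 <= n%:R ^- 2 :> R by rewrite invr_ge0 exprn_ge0 // ltW.
have k0' : 0 < 200^-1 :> R by rewrite invr_gt0.
have cE : (100 * n%:R ^+ 40)^-1 / 200 <= E / 200 by rewrite (ler_pM2r k0').
have h1 : box_radius R n <= E / 200 * X ^- 2 by rewrite rE; exact: ler_pM.
have h2 : E / 200 * X ^- 2 <= E / 200 * X^-1.
  by apply: ler_wpM2l; [apply: divr_ge0; exact: ltW | exact: ltW].
split; [exact: r0 | exact: h1 | exact: le_trans h2 |].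
have n40' : 1 <= n%:R ^+ 40 :> R by rewrite exprn_ege1 // ler1n.
have h3 : (100 * n%:R ^+ 40)^-1 <= 100^-1 :> R.
  by rewrite lef_pV2 ?posrE ?mulr_gt0 //; lra.
have c100 : (100 * n%:R ^+ 40)^-1 / 200 <= 100^-1 / 200 :> R by rewrite (ler_pM2r k0').
rewrite rE; apply: (@le_lt_trans _ _ (100^-1 / 200 * X ^- 2)); first exact: ler_pM.
by rewrite ltr_pM2l //; apply: divr_gt0 => //; rewrite invr_gt0 ltr0n.
Qed.

Lemma entry_bounds (R : realFieldType) (X x E w : R) : 11/10 <= X -> 0 < E <= 100^-1 ->
  `|x - X| <= E / 8 * X -> `|w| <= E / 100 * X ^- 2 ->
  [/\ 1 < x, 0 < x ^- 2 <= 9/10, `|w| <= E / 60 * x ^- 2, - x ^- 2 < w &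
  forall a, `|a - x ^- 2| <= E / 20 * x ^- 2 -> `|a - X ^- 2| <= E * X ^- 2].
Proof.
move=> X1 /andP[E0 E1] hx hw.
have e1 : 0 <= E / 8 <= 100^-1 by apply/andP; split; lra.
have X0 : 0 < X by lra.
have hb := expNr2_near X0 e1 hx.
have x1 : 108/100 < x by move: hx; rewrite ler_norml => /andP[? ?]; nra.
have x2 : 0 < x ^+ 2 by rewrite exprn_gt0 //; lra.
have b0 : 0 < x ^- 2 by rewrite invr_gt0.
have b1 : x ^- 2 <= 9/10.
  have : 1 <= 9/10 * x ^+ 2 by rewrite expr2; nra.
  by rewrite -ler_pdivrMr // mul1r.
have B0 : 0 < X ^- 2 by rewrite invr_gt0 exprn_gt0.
have x3 : 1 < x by lra.
move: (x ^- 2) (X ^- 2) hb b0 b1 B0 hw => b B hb b0 b1 B0 hw.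
clear X1 hx e1 X0 x1 x2.
have EB : 0 < E * B by rewrite mulr_gt0.
have EB1 : E * B <= 100^-1 * B by apply: ler_wpM2r; [exact: ltW|].
move: (hb); rewrite ler_norml => /andP[hb1 hb2].
have EE1 : E * (99/100 * B) <= E * b by apply: ler_wpM2l; lra.
have EE2 : E * b <= E * (101/100 * B) by apply: ler_wpM2l; lra.
have hw2 : `|w| <= E / 60 * b by lra.
split=> //; first by rewrite b0.
  have : E / 60 * b < b by rewrite gtr_pMl //; lra.
  by move: hw2; rewrite ler_norml => /andP[? _]; lra.
move=> a ha; have -> : a - B = (a - b) + (b - B) by ring.
by apply: le_trans (ler_normD _ _) _; lra.
Qed.

Lemma velocity_wall (R : realType) (r phi : R) : 0 < r -> cos phi != 0 ->
  velocity hyperbola (r, phi) = (cos phi, cos phi * - (sin phi / cos phi)).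
Proof.
move=> r0 c0; rewrite /velocity /tangent /normal ltNge ltW //=.
by rewrite !pairE /GRing.scale /=; congr pair; [ring | field].
Qed.

(** The errors of the first collision: the position and the direction at the wall
have to be controlled relatively to the height [X^-1] and to the slope
[X ^- 2] of the curve at the first collision. *)
Lemma wall_entry (R : realType) (X E r phi : R) : 11/10 <= X -> 0 < E <= 100^-1 ->
  0 < r < 1 -> `|1 - r - X^-1| <= E / 200 * X^-1 -> `|phi| <= E / 200 * X ^- 2 ->
  M5 hyperbola (r, phi) /\
  exists p0 x a, [/\ T5 hyperbola (r, phi) = Some p0, leaves x (heading a) p0,
    `|x - X| <= E * X & `|a - X ^- 2| <= E * X ^- 2].
Proof.
move=> X1 E01 r01 hr hphi; have X0 : 0 < X by lra.
case/andP: (E01) => E0 E1.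
have X2 : 0 < X ^- 2 < 1 by apply: expNr2_itv; lra.
case/andP: X2 => B0 B1.
have i0 : 0 < X^-1 by rewrite invr_gt0.
have phi2 : `|phi| <= 2^-1 by apply: le_trans hphi _; nra.
have [phi1 c1 hw] := small_angle phi2.
have c0 : 0 < cos phi by lra.
have Mp : M5 hyperbola (r, phi) by split => //; right; rewrite add0r invr1.
split=> //; set w := - (sin phi / cos phi).
have hw1 : `|w| <= E / 100 * X ^- 2 by rewrite normrN; apply: le_trans hw _; lra.
have EB : 0 < E * X ^- 2 by rewrite mulr_gt0.
have Ei : 0 < E * X^-1 by rewrite mulr_gt0.
have hit : exists2 x, `|x - X| <= E / 8 * X & 1 - r + w * (x - 1) = x^-1.
  apply: entry_hit; [lra | apply/andP; split; lra | |].
    by apply: le_trans hr _; lra.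
  by apply: le_trans hw1 _; lra.
have [x hx ex] := hit.
have [x1 b01 hw2 wb near] := entry_bounds X1 E01 hx hw1.
have qw : cos phi ^+ 2 + (cos phi * w) ^+ 2 = 1.
  rewrite /w mulrN mulrC divfK ?gt_eqF // sqrrN; exact: cos2Dsin2.
have vp := velocity_wall (proj1 (andP r01)) (lt0r_neq0 c0).
have [p0 T0 L0] := T5_from_wall Mp erefl r01 vp c0 qw x1 wb ex.
have E01' : 0 <= E <= 1.
  by rewrite (ltW E0) /=; apply: le_trans E1 _; rewrite invf_le1 ?ltr0n // ler1n.
have [a ha hd] := entry_velocity b01 E01' c0 qw hw2.
move: L0; rewrite reflect_curve_r //= hd => L0.
exists p0, x, a; split=> //; last exact: near.
by apply: le_trans hx _; apply: ler_wpM2r; lra.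
Qed.

(** The box is centred at the horizontal velocity from the height [1 / X 0], which
is where the reference excursion crosses the wall. *)
Lemma return_box (R : realType) (N : nat) : (6 <= N)%N ->
  exists r0 : R, forall p : R * R,
    `|p.1 - r0| <= box_radius R N.+1 -> `|p.2| <= box_radius R N.+1 ->
    exists p', [/\ 0 < p.1 < 1, M5 hyperbola p, T5_iter hyperbola N.+1 p = Some p',
      0 < p'.1 < 1 & M5 hyperbola p'].
Proof.
move=> N6; have [X [A tr]] := traversal_exists R N6.
have X1 := trav_ge tr 0; have XN := trav_le tr.
have N1 : (1 < N)%N by lia.
have kN : ((N - 2).+1 < N)%N by lia.
have eN : N = (N - 2).+2 by lia.
have E0 := tolerance_ge0 R (ltnW N1) N1.
have E1 := tolerance_le R (ltnW N1) N1.
have ER : (100 * N.+1%:R ^+ 40)^-1 <= tolerance R N 0 1.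
  apply: le_trans (tolerance_first R N1).
  have N0 : 0 < N%:R :> R by rewrite ltr0n (ltnW N1).
  have h1 : 0 < N%:R ^+ 40 :> R by rewrite exprn_gt0.
  have h2 : N%:R ^+ 40 <= N.+1%:R ^+ 40 :> R.
    by apply: lerXn2r; rewrite ?nnegrE ?ler_nat.
  have h3 : 0 < 100 * N%:R ^+ 40 :> R by rewrite mulr_gt0 // ltr0n.
  have h4 : 100 * N%:R ^+ 40 <= 100 * N.+1%:R ^+ 40 :> R by rewrite ler_pM2l // ltr0n.
  by rewrite lef_pV2 ?posrE //; exact: lt_le_trans h4.
have [rho0 rho1 rho2 rho3] : [/\ 0 < box_radius R N.+1,
  box_radius R N.+1 <= tolerance R N 0 1 / 200 * X 0%N ^- 2,
  box_radius R N.+1 <= tolerance R N 0 1 / 200 * (X 0%N)^-1 &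
  box_radius R N.+1 < 100^-1 / 200 * (X 0%N)^-1].
  have X11 : 1 < X 0%N <= N.+1%:R by rewrite XN andbT; lra.
  by apply: box_radius_le => //; rewrite ER; lra.
exists (1 - (X 0%N)^-1); case=> r phi; rewrite [_.1]/= [_.2]/= => hr hphi.
have r01 : 0 < r < 1.
  have i1 : (X 0%N)^-1 <= (11/10)^-1 by rewrite lef_pV2 ?posrE; lra.
  by move: hr; rewrite ler_norml => /andP[? ?]; apply/andP; split; lra.
have hr' : `|1 - r - (X 0%N)^-1| <= tolerance R N 0 1 / 200 * (X 0%N)^-1.
  by rewrite -normrN; apply: le_trans rho2; rewrite (le_trans _ hr) // le_eqVlt; apply/orP; left; apply/eqP; congr `|_|; ring.
have E01 : 0 < tolerance R N 0 1 <= 100^-1 by rewrite E0.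
have [Mp [p0 [x [a [T0 L0 hx ha]]]]] := wall_entry X1 E01 r01 hr' (le_trans hphi rho1).
rewrite -(trav_first tr) in ha.
have [xk [ak [pk [Tk Lk hxk hak]]]] := shadow tr kN T0 L0 hx ha.
move: (N - 2)%N eN tr Tk Lk hxk hak => m -> {N N6 X1 XN N1 E0 E1 ER rho0 rho1 rho2 rho3 hr hphi hr' E01 T0 L0 hx ha kN} tr Tk Lk hxk hak.
have [p1 [p2 [T1 T2 p21 Mp2]]] := shadow_exit tr Lk hxk hak.
exists p2; split=> //.
rewrite -[LHS]/(obind (T5 hyperbola) (obind (T5 hyperbola) (T5_iter hyperbola m.+1 (r, phi)))).
by rewrite Tk /= T1 /= T2.
Qed.

(** * Rectangles and their measure *)

(** No measurability of [D] or [f] is assumed: the integral of a nonnegative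
function is a supremum over simple functions. This spares the measurability of
the preimages under the billiard map. *)
Lemma ge0_le_integral_subset d (T : measurableType d) (R : realType)
  (m : {measure set T -> \bar R}) (B D : set T) (g f : T -> \bar R) :
  (forall x, B x -> 0 <= g x)%E -> (forall x, D x -> 0 <= f x)%E ->
  B `<=` D -> (forall x, B x -> g x <= f x)%E ->
  (\int[m]_(x in B) g x <= \int[m]_(x in D) f x)%E.
Proof.
move=> g0 f0 BD gf; rewrite !ge0_integralE //.
apply: ereal_sup_le => _ [h hg <-]; exists h => // x.
apply: le_trans (hg x) _; rewrite /patch; case: ifPn => [|_].
  rewrite inE => Bx; rewrite ifT ?inE; last exact: BD.
  exact: gf.
by case: ifPn => // ; rewrite inE => /f0.
Qed.

Lemma segment_derivable (R : realType) (u v : R * R) (t : R) : v != 0 ->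
  derivable (fun t : R => u + t *: v) t 1 /\ derive1 (fun t : R => u + t *: v) t != 0.
Proof.
move=> v0.
have c : h^-1 *: (((fun t : R => u + t *: v) \o shift t) (h *: 1) - (u + t *: v))
   @[h --> (0 : R)^'] --> v.
  apply: cvg_near_cst; near=> h.
  have h0 : h != 0 by near: h; exact: nbhs_dnbhs_neq.
  rewrite /= scalerDl addrA (addrC u) -addrA addrK.
  by rewrite scalerA scaler1 mulVf // scale1r.
split; first by apply/cvg_ex; exists v.
by rewrite derive1E /derive (cvg_lim _ c).
Unshelve. all: by end_near.
Qed.

(** The segment from the centre to a point of the closed rectangle consists of
interior points, apart possibly from its end. *)
Lemma rectangle_closure (R : realType) (a b c d : R) : a < b -> c < d ->
  closure (`]a, b[ `*` `]c, d[ : set (R * R)) = `[a, b] `*` `[c, d].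
Proof.
move=> ab cd; rewrite eqEsubset; split.
  have cl : closed (`[a, b] `*` `[c, d] : set (R * R)).
    have -> : `[a, b] `*` `[c, d] = (fst @^-1` `[a, b]) `&` (snd @^-1` `[c, d]) :> set (R * R).
      by [].
    apply: closedI; apply: preimage_closed => [p _|]; try exact: itv_closed.
      exact: cvg_fst.
    exact: cvg_snd.
  rewrite [X in _ `<=` X](closure_id _).1 //; apply: closure_subset.
  by move=> [x y] [/= h1 h2]; split; apply: subset_itv_oo_cc.
move=> [x y] [/= /[!in_itv]/= /andP[x1 x2] /andP[y1 y2]] B nB.
pose v := ((a + b) / 2 - x, (c + d) / 2 - y) : R * R.
have cn : {for (0 : R), continuous (fun e : R => (x, y) + e *: v)}.
  by apply: cvgD; [exact: cvg_cst | apply: cvgZr_tmp; exact: cvg_id].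
have : nbhs (0 : R) ((fun e : R => (x, y) + e *: v) @^-1` B).
  by apply: cn; rewrite scale0r addr0.
case/nbhs_ballP => e /= e0 sub.
pose t := Num.min (e / 2) 2^-1.
have t0 : 0 < t by rewrite lt_min divr_gt0 //=; lra.
have t1 : t <= 2^-1 by rewrite ge_min lexx orbT.
have t2 : t <= e / 2 by rewrite ge_min lexx.
exists ((x, y) + t *: v); split; last first.
  by apply: sub; rewrite /ball /= sub0r normrN gtr0_norm //; lra.
split; rewrite /= in_itv /= /v /GRing.scale /=; apply/andP; split; nra.
Qed.

Lemma rectangle_open (R : realType) (a b c d : R) :
  open (`]a, b[ `*` `]c, d[ : set (R * R)).
Proof.
have -> : `]a, b[ `*` `]c, d[ = (fst @^-1` `]a, b[) `&` (snd @^-1` `]c, d[) :> set (R * R).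
  by [].
apply: openI; apply: open_comp => [p _|]; try exact: itv_open.
  exact: cvg_fst.
exact: cvg_snd.
Qed.

Lemma rectangle_boundary (R : realType) (a b c d : R) : a < b -> c < d ->
  piecewise_differentiable_boundary (`]a, b[ `*` `]c, d[ : set (R * R)).
Proof.
move=> ab cd.
pose s (i : nat) : (R * R) * (R * R) :=
  nth ((a, c), (b - a, 0)) [:: ((a, c), (b - a, 0)); ((a, d), (b - a, 0));
    ((a, c), (0, d - c)); ((b, c), (0, d - c))] i.
exists 4, (fun i t => (s i).1 + t *: (s i).2); split.
  move=> i t _; apply: segment_derivable.
  by case: i => [[|[|[|[|//]]]] ?]; apply/eqP => -[]; lra.
rewrite rectangle_closure //.
have -> : (`]a, b[ `*` `]c, d[ : set (R * R))° = `]a, b[ `*` `]c, d[.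
  by apply/interior_id; exact: rectangle_open.
rewrite eqEsubset; split.
  move=> [x y] [[/= /[!in_itv]/= /andP[x1 x2] /andP[y1 y2]] /= nin].
  have par u v z : u < v -> u <= z <= v -> exists2 t : R, 0 <= t <= 1 & z = u + t * (v - u).
    move=> uv /andP[z1 z2]; exists ((z - u) / (v - u)).
      apply/andP; split; first by apply: divr_ge0; lra.
      by rewrite ler_pdivrMr; lra.
    by rewrite divfK ?subr_eq0 ?gt_eqF //; ring.
  have [tx tx1 ex] : exists2 t : R, 0 <= t <= 1 & x = a + t * (b - a) by apply: par; rewrite ?x1.
  have [ty ty1 ey] : exists2 t : R, 0 <= t <= 1 & y = c + t * (d - c) by apply: par; rewrite ?y1.
  have side (i : nat) (i4 : (i < 4)%N) (t : R) : 0 <= t <= 1 -> (s i).1 + t *: (s i).2 = (x, y) ->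
      (\bigcup_(i : 'I_4) ((fun t : R => (s i).1 + t *: (s i).2) @` `[0, 1])) (x, y).
    by move=> t1 e; exists (Ordinal i4) => //; exists t => //; rewrite /= in_itv.
  have [ec|nc] := eqVneq y c.
    by apply: (side 0 isT tx) => //; rewrite -[LHS]/(a + tx * (b - a), c + tx * 0) -ex ec mulr0 addr0.
  have [ed|nd] := eqVneq y d.
    by apply: (side 1 isT tx) => //; rewrite -[LHS]/(a + tx * (b - a), d + tx * 0) -ex ed mulr0 addr0.
  have [ea|na] := eqVneq x a.
    by apply: (side 2 isT ty) => //; rewrite -[LHS]/(a + ty * 0, c + ty * (d - c)) -ey ea mulr0 addr0.
  have [eb|nb] := eqVneq x b.
    by apply: (side 3 isT ty) => //; rewrite -[LHS]/(b + ty * 0, c + ty * (d - c)) -ey eb mulr0 addr0.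
  exfalso; apply: nin; split; rewrite /= ?in_itv /= !lt_neqAle.
    by rewrite eq_sym na nb x1 x2.
  by rewrite eq_sym nc nd y1 y2.
move=> p [i _ [t /=]]; rewrite in_itv /= => /andP[t0 t1] <-.
have tb : 0 <= t * (b - a) <= b - a.
  by apply/andP; split; nra.
have td : 0 <= t * (d - c) <= d - c.
  by apply/andP; split; nra.
case/andP: tb => tb1 tb2; case/andP: td => td1 td2.
case: i => [[|[|[|[|//]]]] ?]; rewrite /s /= /GRing.scale /= ?mulr0 ?addr0; split.
all: try (by split; rewrite /= in_itv /= ?mulr0 ?addr0; apply/andP; split; lra).
all: by move=> [/= /[!in_itv]/= /andP[? ?] /andP[? ?]]; lra.
Qed.

Lemma mu_ge_box (R : realType) (f : R -> R) (r0 rho : R) (S : set (R * R)) :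
  0 < rho <= 2^-1 ->
  (forall p : R * R, `|p.1 - r0| <= rho -> `|p.2| <= rho -> 2^-1 <= cos p.2 /\ S p /\ M5 f p) ->
  ((2 * rho ^+ 2)%:E <= mu f S)%E.
Proof.
move=> /andP[rho0 rho1] sub.
pose B : set (R * R) := `[r0 - rho, r0 + rho] `*` `[- rho, rho].
have BE p : B p -> 2^-1 <= cos p.2 /\ S p /\ M5 f p.
  move=> [/= /[!in_itv]/= /andP[h1 h2] /andP[h3 h4]]; apply: sub; rewrite ler_norml; apply/andP; split; lra.
apply: (@le_trans _ _ (\int[lebesgue_measure \x lebesgue_measure]_(p in B) (cst (2^-1)%:E p))%E); last first.
  apply: ge0_le_integral_subset.
  - by move=> p _; rewrite /= lee_fin.
  - by move=> p [_ [_ /= h]]; rewrite lee_fin; apply: ltW; exact: cos_gt0_pihalf.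
  - by move=> p /BE[_ [? ?]].
  - by move=> p /BE[h _]; rewrite lee_fin.
rewrite integral_cst; last by apply: measurableX; exact: measurable_itv.
have mB : (lebesgue_measure \x lebesgue_measure)%E B = ((2 * rho)%:E * (2 * rho)%:E)%E.
  rewrite /B product_measure1E; [|exact: measurable_itv|exact: measurable_itv].
  rewrite /= !lebesgue_measure_itv /= !lte_fin.
  rewrite ifT; last by lra.
  rewrite ifT; last by lra.
  by rewrite -!EFinD; congr (_%:E * _%:E)%E; ring.
apply: (@le_trans _ _ ((2^-1)%:E * ((2 * rho)%:E * (2 * rho)%:E))%E); last by rewrite -mB.
rewrite -!EFinM lee_fin expr2; lra.
Qed.

Definition wall (R : realType) : set (R * R) := `]0, 1[ `*` `]- (pi / 2), pi / 2[.

Lemma measurable_wall (R : realType) : measurable (@wall R).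
Proof. by apply: measurableX; exact: measurable_itv. Qed.

Lemma wallP (R : realType) (p : R * R) :
  wall p <-> 0 < p.1 < 1 /\ - (pi / 2) < p.2 < pi / 2.
Proof. by rewrite /wall; split => -[/=]; rewrite !in_itv. Qed.

Lemma wall_sub (R : realType) : @wall R `<=` M5 hyperbola.
Proof. by move=> p /wallP[h1 h2]; split => //; right; rewrite add0r invr1. Qed.

Lemma mu_wall_lty (R : realType) : (mu hyperbola (@wall R) < +oo)%E.
Proof.
have wM : @wall R `&` M5 hyperbola = @wall R by apply/setIidl; exact: wall_sub.
rewrite /mu wM.
apply: (@le_lt_trans _ _ (\int[lebesgue_measure \x lebesgue_measure]_(p in @wall R) (cst 1%:E p))%E).
  apply: ge0_le_integral_subset => //.
  - by move=> p /wallP[_ h]; rewrite lee_fin; apply: ltW; exact: cos_gt0_pihalf.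
  - by move=> p _; rewrite lee_fin cos_le1.
rewrite integral_cst; last exact: measurable_wall.
have mB : (lebesgue_measure \x lebesgue_measure)%E (@wall R) = (1%:E * (pi)%:E)%E.
  rewrite /wall product_measure1E; [|exact: measurable_itv|exact: measurable_itv].
  have p0 := pi_gt0 R.
  rewrite /= !lebesgue_measure_itv /= !lte_fin ltr01.
  rewrite ifT; last by lra.
  by rewrite -!EFinD; congr (_%:E * _%:E)%E; lra.
apply: (@le_lt_trans _ _ (1%:E * (1%:E * pi%:E))%E); first by rewrite -mB.
by rewrite -!EFinM ltry.
Qed.

(** * Polynomial mixing *)

Theorem theorem2 (R : realType) :
  let f := fun x : R => (x + 1)^-1 in
  exists2 alpha : R, 0 < alpha &
  exists A : set (R * R),
    [/\ measurable A, A `<=` M5 f, piecewise_differentiable_boundary A,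
        (0 < mu f A < +oo)%E &
        exists2 C : R, 0 < C &
          \forall n \near \oo,
            ((C * (n%:R `^ alpha)^-1)%:E <=
               mu f (T5_preimage f n A `&` A))%E].
Proof.
move=> f; exists 84%:R => //; exists (@wall R).
have pi0 := pi_gt0 R.
split.
- exact: measurable_wall.
- exact: (@wall_sub R).
- by apply: rectangle_boundary => //; lra.
- rewrite mu_wall_lty andbT.
  apply: (@lt_le_trans _ _ (2 * 4^-1 ^+ 2)%:E).
    by rewrite lte_fin mulr_gt0 // exprn_gt0.
  apply: (@mu_ge_box _ _ (2^-1)); first by apply/andP; split; lra.
  move=> p hp1 hp2.
  have [|h1 h2 _] := @small_angle _ p.2; first by lra.
  have wp : wall p.
    apply/wallP; split => //; move: hp1; rewrite ler_norml => /andP[? ?].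
    by apply/andP; split; lra.
  by split=> //; split => //; exact: (@wall_sub R).
exists (2 / (200 * 100) ^+ 2); first by rewrite divr_gt0 // exprn_gt0.
(* writing [n = N + 1], the excursion has [N] collisions with the curve *)
exists 7 => // -[//|N] /= N7.
have [r0 box] := return_box R N7.
rewrite powR_mulrn //.
have n0 : (N.+1%:R : R) != 0 by rewrite pnatr_eq0.
have -> : 2 / (200 * 100) ^+ 2 / N.+1%:R ^+ 84 = 2 * box_radius R N.+1 ^+ 2 :> R.
  rewrite /box_radius (exprM _ 42 2).
  have : N.+1%:R ^+ 42 != 0 :> R by rewrite expf_neq0.
  by move: (N.+1%:R ^+ 42) => u u0; field.
have n1 : 1 <= N.+1%:R ^+ 42 :> R by rewrite exprn_ege1 // ler1n.
have rad : 0 < box_radius R N.+1 <= 2^-1.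
  rewrite /box_radius; move: (N.+1%:R ^+ 42) n1 => u u1.
  have u0 : 0 < 200 * 100 * u by lra.
  by rewrite invr_gt0 u0 /= lef_pV2 ?posrE //; lra.
apply: (@mu_ge_box _ _ r0) => // p hp1 hp2.
have [|h1 h2 _] := @small_angle _ p.2.
  by case/andP: rad => _; apply: le_trans.
have [p' [p01 Mp Tp p'01 [_ Mp']]] := box p hp1 hp2.
split=> //; split=> //; split; last by apply/wallP.
by split=> //; exists p' => //; apply/wallP.
Qed.
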